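(* Let $k$ be a positive integer, $F=\{1,2,\dots,k\}$. Let $\alpha,c,N$ be real numbers such that none of $\alpha+c-N+k+2$, $\alpha-N+1$, $\alpha+c$, $c$ belongs to $\{0,-1,-2,\dots\}$. Put $\mathfrak{p}_{-c-F}(x)=\prod_{j\in F}(x+c+j)$ and let $$h(x)=\sum_{j=0}^k\frac{(-k)_j(1-\alpha-c-k+j)_{k-j}(1-c-k+j)_{k-j}}{j!}(-1)^j\prod_{i=0}^{j-1}\big[x+i(\alpha+c-N+k-1-i)\big]$$ (a dual Hahn polynomial). Assume that $$h\big(n(n+\alpha+c+k-N-1)\big)\neq 0\quad\text{for all } n\ge 0.$$ Then the orthogonal polynomials with respect to the measure $\mathfrak{p}_{-c-F}\,\rho_{\alpha,c,N}$, where $\rho_{\alpha,c,N}$ is the Hahn moment functional, are common eigenfunctions of a difference operator of order $2k+2$ and genre $(-k-1,k+1)$.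
   Context: For $l\in\mathbb{Z}$ the shift operator $\mathfrak{s}_l$ acts on polynomials by $\mathfrak{s}_l(f)(x)=f(x+l)$. A finite difference operator $\sum_{l=s}^r f_l\,\mathfrak{s}_l$ (with polynomial coefficients $f_l$) with $f_s,f_r\neq 0$ has order $r-s$ and genre $(s,r)$. Polynomials $(q_n)_n$ are common eigenfunctions of such an operator $D$ (whose coefficients do not depend on $n$) if $D(q_n)=\lambda_nq_n$ for some numbers $\lambda_n$. $(y)_j=y(y+1)\cdots(y+j-1)$, $(y)_0=1$; empty products equal $1$. Monic Hahn polynomials ($\alpha+c-N\neq -1,-2,\dots$): $h_n^{\alpha,c,N}(x)=\sum_{j=0}^n\frac{(-n)_j(-x)_j(1-N+j)_{n-j}(c+j)_{n-j}}{(n+\alpha+c-N+j)_{n-j}\,j!}$. A moment functional is a linear map $\mu:\mathbb{P}\to\mathbb{R}$ on the space $\mathbb{P}$ of real polynomials; for a polynomial $r$, $\langle r\mu,p\rangle=\langle\mu,rp\rangle$. Hahn moment functional $\rho_{\alpha,c,N}$: if $N$ is not a positive integer and none of $\alpha+c-N+1,\alpha-N+1,\alpha+c,c$ is in $\{0,-1,-2,\dots\}$, it is the moment functional with respect to which $(h_n^{\alpha,c,N})_n$ are orthogonal, normalized by $\langle\rho_{\alpha,c,N},1\rangle=\frac{\Gamma(\alpha+1-N)\Gamma(c)\Gamma(\alpha+c)}{\Gamma(\alpha+c+1-N)}$; if $N$ is a positive integer, it is the measure $\rho_{\alpha,c,N}=\Gamma(N)\sum_{x=0}^{N-1}\frac{\Gamma(\alpha-x)\Gamma(x+c)}{\Gamma(N-x)x!}\delta_x$.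 Orthogonal polynomials with respect to $\mu$ are polynomials $(q_n)_n$ (a finite or infinite family) with $\deg q_n=n$, $\langle\mu,q_nx^m\rangle=0$ for $0\le m<n$ and $\langle\mu,q_nx^n\rangle\neq 0$. *)

(* Defs.v *)
From HB Require Import structures.
From mathcomp Require Import all_boot all_order all_algebra.
From mathcomp Require Import all_classical all_reals all_analysis.

Set Implicit Arguments.
Unset Strict Implicit.
Unset Printing Implicit Defensive.

Import Order.TTheory GRing.Theory Num.Theory.
Import numFieldNormedType.Exports.

Local Open Scope ring_scope.

(* rising factorial; also used with A = {poly R}, for (- 'X)_j *)
Definition pochhammer (A : pzRingType) (y : A) (j : nat) : A :=
  \prod_(i < j) (y + i%:R).

Section Gamma.
Variable R : realType.

Definition nonpositive_integer (y : R) : Prop := exists m : nat, y = - m%:R.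

Definition positive_integer (y : R) : Prop :=
  exists m : nat, (0 < m)%N /\ y = m%:R.

Definition Gamma_integral (x : R) : R :=
  (\int[lebesgue_measure]_(t in `]0%R, +oo[%classic)
     (t `^ (x - 1) * expR (- t)))%R.

(* Continuation by Gamma (x + m) = (x)_m * Gamma x; any m with 0 < x + m gives
   the same value, and Num.bound x is such an m. At the poles x = 0, -1, ...
   the denominator vanishes and the value is the junk value 0. *)
Definition Gamma (x : R) : R :=
  let m := Num.bound x in Gamma_integral (x + m%:R) / pochhammer x m.

End Gamma.

Section DifferenceOperators.
Variable R : realType.

Definition shift_op (l : int) (p : {poly R}) : {poly R} :=
  p \Po ('X + (l%:~R)%:P).

Definition has_genre (D : {poly R} -> {poly R}) (s r : int) : Prop :=
  exists f : int -> {poly R},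
    [/\ s <= r, f s != 0, f r != 0 &
        forall p, D p = \sum_(i < `|r - s|%N.+1)
                          f (s + i%:Z) * shift_op (s + i%:Z) p].

Definition has_order (D : {poly R} -> {poly R}) (m : nat) : Prop :=
  exists s r : int, has_genre D s r /\ r - s = m%:Z.

End DifferenceOperators.

Section OrthogonalPolynomials.
Variable R : realType.

Definition mul_functional_fun (r : {poly R}) (mu : {scalar {poly R}})
    (p : {poly R}) : R :=
  mu (r * p).

Fact mul_functional_is_scalar r mu : scalar (mul_functional_fun r mu).
Proof. by move=> a p q; rewrite /mul_functional_fun mulrDr -scalerAr linearP. Qed.

HB.instance Definition _ r mu :=
  GRing.isLinear.Build R {poly R} R *%R (mul_functional_fun r mu)
    (mul_functional_is_scalar r mu).

(* the functional r mu *)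
Definition mul_functional (r : {poly R}) (mu : {scalar {poly R}}) :
    {scalar {poly R}} :=
  mul_functional_fun r mu.

(* The index set of a family (q_n)_n: all of nat, or {0, ..., M - 1}. *)
Definition initial_segment (I : pred nat) : Prop :=
  forall m n : nat, (m <= n)%N -> I n -> I m.

Definition orthogonal_family (mu : {scalar {poly R}}) (I : pred nat)
    (q : nat -> {poly R}) : Prop :=
  forall n, I n ->
    [/\ size (q n) = n.+1,
        forall m, (m < n)%N -> mu (q n * 'X^m) = 0
      & mu (q n * 'X^n) != 0].

Definition common_eigenfunctions (D : {poly R} -> {poly R}) (I : pred nat)
    (q : nat -> {poly R}) : Prop :=
  exists lam : nat -> R, forall n, I n -> D (q n) = lam n *: q n.

End OrthogonalPolynomials.

Section Hahn.
Variable R : realType.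
Implicit Types alpha c N : R.

Definition hahn_poly alpha c N (n : nat) : {poly R} :=
  \sum_(j < n.+1)
    (pochhammer (- n%:R : R) j * pochhammer (1 - N + j%:R) (n - j)
       * pochhammer (c + j%:R) (n - j)
       / (pochhammer (n%:R + alpha + c - N + j%:R) (n - j) * j`!%:R))
    *: pochhammer (- 'X : {poly R}) j.

Definition hahn_functional alpha c N (mu : {scalar {poly R}}) : Prop :=
     [/\ ~ positive_integer N,
         [/\ ~ nonpositive_integer (alpha + c - N + 1),
             ~ nonpositive_integer (alpha - N + 1),
             ~ nonpositive_integer (alpha + c)
           & ~ nonpositive_integer c],
         orthogonal_family mu predT (hahn_poly alpha c N)
       & mu 1 = Gamma (alpha + 1 - N) * Gamma c * Gamma (alpha + c)
                  / Gamma (alpha + c + 1 - N)]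
  \/ exists M : nat,
       [/\ (0 < M)%N, N = M%:R
         & forall p : {poly R}, mu p =
             Gamma N * \sum_(x < M)
               Gamma (alpha - x%:R) * Gamma (x%:R + c)
                 / (Gamma (N - x%:R) * x`!%:R) * p.[x%:R]].

Definition dual_hahn_poly alpha c N (k : nat) : {poly R} :=
  \sum_(j < k.+1)
    (pochhammer (- k%:R : R) j
       * pochhammer (1 - alpha - c - k%:R + j%:R) (k - j)
       * pochhammer (1 - c - k%:R + j%:R) (k - j)
       / j`!%:R * (-1) ^+ j)
    *: \prod_(i < j)
         ('X + (i%:R * (alpha + c - N + k%:R - 1 - i%:R))%:P).

(* the polynomial p_{-c-F} for F = {1, ..., k} *)
Definition christoffel_poly c (k : nat) : {poly R} :=
  \prod_(1 <= j < k.+1) ('X + (c + j%:R)%:P).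

End Hahn.

(* Main.v *)
From HB Require Import structures.
Require Import Defs.
From mathcomp Require Import all_boot all_order all_algebra.
From mathcomp Require Import all_classical all_reals all_analysis.
From mathcomp Require Import measurable_realfun.
From mathcomp Require Import ring lra zify.

(** Put c' = c + k + 1, a = alpha + c' - N and lam_n = n (n + a).  Write rho_i
    for the functional (x+c)(x+c+1)...(x+c+i-1) rho, and let mu be the
    functional p_{-c-F} rho of the statement.  Since (x+c) mu = rho_{k+1} is
    the Hahn functional with parameter c', mu is a Geronimus transform of a
    classical functional, so its orthogonal polynomials combine two consecutive
    eigenpolynomials r_n of the Hahn operator L of parameter c'
    (L r_n = - lam_n r_n).

    Whichever way rho is given, it satisfies a Pearson equation
    ([pearson_hahn]), and all rho_i inherit one.  From it,
    j (c+i) (alpha+c+i) rho_i = rho_{i+1} o (- L + j (a-j)) for i + j = k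
    ([pearson_factor]).  Expanding p_{-c-F} in the polynomials
    (x+c)...(x+c+i-1) and collecting factors, one finds that mu is a nonzero
    multiple of rho_k o Y, where Y = sum_j d_j K_j,
    K_j = prod_(1 <= i <= j) (- L + i (a-i)) and the d_j are exactly the
    coefficients of the dual Hahn polynomial h ([pearson_krall_sum]).
    Consequently Y r_n = h_{n+1} r_n with h_n = h (n (n + a - 2)).

    Now rho_k is the Hahn functional with parameter c' - 1, and its
    eigenpolynomials are p_n = r_n + b_n r_{n-1}, with b_n explicit.  Hence
    q_n = h_n r_n + b_n h_{n+1} r_{n-1} satisfies Y q_n = h_n h_{n+1} p_n, so
    mu (q_n) = 0, while mu ((x+c) g q_n) = rho_{k+1} (g q_n) = 0 for
    deg g < n - 1: the q_n are orthogonal for mu, and of degree n because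
    h_n <> 0 ([krall_poly_orthogonal]).

    The difference operator is D = sum_j d_j (E - L / (j+1)) K_j with
    E = (N-1-x) Delta.  As E is the difference between L and the Hahn operator
    of parameter c' - 1, it is known on p_n, and D q_n = P_n q_n holds with
    P_n = sum_j d_j / (j+1) prod_(0 <= i <= j) (n+i) (n+a-1-i), which satisfies
    P_n - P_{n-1} = (2n+a-2) h_n ([krall_op_poly]).  The term j = k alone
    reaches the shifts by k+1 and -k-1, and its extreme coefficients are
    products of nonzero polynomials ([banded_krall_op]).

    When a = 0 the polynomial q_1 degenerates; but then either N = 1 and mu is
    a point mass, or mu (1) = 0, and no orthogonal family reaches degree 1
    ([krall_degenerate]). *)

Set Implicit Arguments.
Unset Strict Implicit.
Unset Printing Implicit Defensive.

Import Order.TTheory GRing.Theory Num.Theory.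
Local Open Scope ring_scope.

(** * Rising factorials *)

Section Pochhammer.
Variable R : realType.

Lemma pochhammerSr (A : pzRingType) (y : A) m :
  pochhammer y m.+1 = pochhammer y m * (y + m%:R).
Proof. by rewrite /pochhammer big_ord_recr. Qed.

Lemma pochhammerSl (A : pzRingType) (y : A) m :
  pochhammer y m.+1 = y * pochhammer (y + 1) m.
Proof.
rewrite /pochhammer big_ord_recl addr0; congr (_ * _).
by apply: eq_bigr => i _; rewrite /bump /= natrD addrA.
Qed.

Lemma pochhammer_cat (y : R) i j :
  pochhammer y (i + j) = pochhammer y i * pochhammer (y + i%:R) j.
Proof.
rewrite /pochhammer big_split_ord/=; congr (_ * _).
by apply: eq_bigr => l _; rewrite natrD addrA.
Qed.

Lemma pochhammer_reflect (y : R) m :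
  pochhammer (1 - y - m%:R) m = (-1) ^+ m * pochhammer y m.
Proof.
rewrite /pochhammer -[X in _ ^+ X]card_ord -prodr_const -big_split/=.
rewrite [RHS](reindex_inj rev_ord_inj)/=; apply: eq_bigr => i _.
by rewrite natrB// -natr1; ring.
Qed.

Lemma pochhammer_ffact (k j : nat) : (j <= k)%N ->
  pochhammer (- k%:R : R) j * (-1) ^+ j = (k ^_ j)%:R.
Proof.
elim: j => [|j IH] jk; first by rewrite /pochhammer big_ord0 ffactn0 mul1r.
rewrite pochhammerSr ffactnSr natrM -IH ?(ltnW jk)// natrB 1?ltnW// exprS; ring.
Qed.

Lemma pochhammer_neq0 (y : R) i :
  ~ nonpositive_integer y -> pochhammer y i != 0.
Proof.
move=> y_np; apply/prodf_neq0 => l _; apply/eqP => yl; apply: y_np.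
by exists l; apply/eqP; rewrite -addr_eq0 yl.
Qed.

End Pochhammer.

(** * The functional equation of the Gamma function *)

Section GammaRecurrence.
Import numFieldNormedType.Exports.
Local Open Scope classical_set_scope.
Variable R : realType.
Notation mu := (@lebesgue_measure R).

(** The half-line is exhausted by compact intervals staying away from 0, where
    t^(z-1) may blow up. *)
Definition gamma_itv (n : nat) : set R := `[n.+1%:R^-1, n.+2%:R].

Lemma gamma_itv_gt0 n (t : R) : gamma_itv n t -> 0 < t.
Proof.
rewrite /gamma_itv /= in_itv/= => /andP[h _].
by apply: lt_le_trans h; rewrite invr_gt0 ltr0n.
Qed.

Lemma bigcup_gamma_itv : \bigcup_n gamma_itv n = `]0%R, +oo[%classic.
Proof.
apply/seteqP; split => [t [n _ /gamma_itv_gt0 t0]|t].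
  by rewrite /= in_itv/= t0.
rewrite /= in_itv/= andbT => t0.
exists (maxn (Num.bound t) (Num.bound t^-1)) => //=.
rewrite /gamma_itv /= in_itv/=; apply/andP; split.
  rewrite -[leRHS]invrK lef_pV2 ?posrE ?invr_gt0 ?ltr0n//.
  apply: le_trans (_ : (Num.bound t^-1)%:R <= _).
    by rewrite ltW// unstable.ltr_bound.
  by rewrite ler_nat ltnW// ltnS leq_maxr.
apply: le_trans (_ : (Num.bound t)%:R <= _).
  by rewrite ltW// unstable.ltr_bound.
by rewrite ler_nat 2?ltnW// !ltnS leq_maxl.
Qed.

Lemma nondecreasing_gamma_itv : nondecreasing_seq gamma_itv.
Proof.
move=> m n mn; apply/subsetPset => t.
rewrite /gamma_itv /= !in_itv/= => /andP[h1 h2].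
apply/andP; split.
  by apply: le_trans h1; rewrite lef_pV2 ?posrE ?ltr0n// ler_nat ltnS.
by apply: le_trans h2 _; rewrite ler_nat !ltnS.
Qed.

Lemma measurable_gamma_integrand (z : R) (D : set R) :
  measurable_fun D (fun t : R => t `^ z * expR (- t)).
Proof.
apply: (@measurable_funS _ _ _ _ setT) => //.
apply: measurable_funM; first exact: measurable_powR.
by apply: measurableT_comp => //; exact: measurable_oppr.
Qed.

Lemma cvg_gamma_itv (z : R) :
  (\int[mu]_(t in gamma_itv n) (t `^ z * expR (- t))%:E @[n --> \oo] -->
   \int[mu]_(t in `]0%R, +oo[) (t `^ z * expR (- t))%:E)%E.
Proof.
rewrite -bigcup_gamma_itv.
apply: ge0_nondecreasing_set_cvg_integral.
- exact: nondecreasing_gamma_itv.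
- by move=> i; exact: measurable_itv.
- by move=> i; apply/measurable_EFinP; exact: measurable_gamma_integrand.
- by move=> i t _; rewrite lee_fin mulr_ge0// ?powR_ge0 ?expR_ge0.
Qed.

(** The bound exp y >= y at y = t / (z+1), raised to the power z+1. *)
Lemma powR_expRN_le (z t : R) : 0 < z -> 0 < t ->
  t `^ z * expR (- t) <= (z + 1) `^ (z + 1) / t.
Proof.
move=> z0 t0; have z1 : 0 < z + 1 by lra.
have -> : t `^ z = t `^ (z + 1) / t.
  rewrite powRD; last by rewrite gt_eqF.
  by rewrite powRr1 ?ltW// mulfK// gt_eqF.
rewrite mulrAC ler_pM2r ?invr_gt0//.
have -> : expR (- t) = (expR (t / (z + 1)) `^ (z + 1))^-1.
  by rewrite -expRM mulfVK ?gt_eqF// expRN.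
rewrite ler_pdivrMr ?powR_gt0 ?expR_gt0//.
rewrite -powRM ?expR_ge0 ?(ltW z1)//.
apply: ge0_ler_powR; rewrite ?nnegrE ?mulr_ge0 ?expR_ge0 ?(ltW z1) ?(ltW t0)//.
rewrite -ler_pdivrMl// mulrC.
by apply: le_trans (expR_ge1Dx _); rewrite lerDr.
Qed.

Lemma cvg_gamma_upper (z : R) : 0 < z ->
  ((n.+2%:R : R) `^ z * expR (- n.+2%:R) @[n --> \oo] --> (0 : R)).
Proof.
move=> z0.
apply: (@squeeze_cvgr _ _ _ _ (fun _ => 0)
  (fun n => (z + 1) `^ (z + 1) / n.+1%:R)).
- near=> n; apply/andP; split; first by rewrite mulr_ge0 ?powR_ge0 ?expR_ge0.
  apply: (le_trans (@powR_expRN_le z n.+2%:R z0 _)); first by rewrite ltr0n.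
  rewrite ler_wpM2l ?powR_ge0// lef_pV2 ?posrE ?ltr0n//.
  by rewrite ler_nat.
- exact: cvg_cst.
- rewrite -[X in _ --> X](mulr0 ((z + 1) `^ (z + 1))).
  by apply: cvgM; [exact: cvg_cst | exact: cvg_harmonic].
Unshelve. all: by end_near. Qed.

Lemma cvg_gamma_lower (z : R) : 0 < z ->
  ((n.+1%:R^-1 : R) `^ z * expR (- n.+1%:R^-1) @[n --> \oo] --> (0 : R)).
Proof.
move=> z0.
apply: (@squeeze_cvgr _ _ _ _ (fun _ => 0) (fun n => (n.+1%:R^-1 : R) `^ z)).
- near=> n; apply/andP; split; first by rewrite mulr_ge0 ?powR_ge0 ?expR_ge0.
  rewrite ler_piMr ?powR_ge0// expR_le1 oppr_le0 invr_ge0//.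
- exact: cvg_cst.
- have /cvg_at_rightP := powR_cvg0 z0; apply.
  by split => [n|]; [rewrite invr_gt0 ltr0n | exact: cvg_harmonic].
Unshelve. all: by end_near. Qed.

(** Integration by parts takes place on the compact intervals only; the
    boundary terms disappear in the limit. *)
Lemma gamma_by_parts (z : R) n : 0 < z ->
  (z%:E * \int[mu]_(t in gamma_itv n) (t `^ (z - 1) * expR (- t))%:E =
   ((n.+2%:R : R) `^ z * expR (- n.+2%:R) -
    (n.+1%:R^-1 : R) `^ z * expR (- n.+1%:R^-1))%:E
   + \int[mu]_(t in gamma_itv n) (t `^ z * expR (- t))%:E)%E.
Proof.
move=> z0; have ab : n.+1%:R^-1 < n.+2%:R :> R.
  by rewrite (@le_lt_trans _ _ 1) ?invf_le1 ?ltr0n// ?ler1n// ltr1n.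
have dexp (x : R) : is_derive x 1 (fun t : R => expR (- t)) (- expR (- x)).
  have h : is_derive x (1 : R) (fun t : R => - t) (-1) by exact: is_deriveN.
  by have := is_derive1_comp (is_derive_expR (- x)) h; rewrite mulrN1.
have cexp : continuous (fun t : R => expR (- t)).
  move=> x; apply: differentiable_continuous; apply/derivable1_diffP.
  by case: (dexp x).
have cpow (w x : R) : 0 < x -> {for x, continuous (fun t : R => t `^ w)}.
  move=> x0; apply: differentiable_continuous; apply/derivable1_diffP.
  by have /= := is_derive1_powR w x0; case.
have a0 : 0 < n.+1%:R^-1 :> R by rewrite invr_gt0 ltr0n.
have b0 := lt_trans a0 ab.
have := @integration_by_parts R (fun t => expR (- t)) (fun t => t `^ z)
  (fun t => - expR (- t)) (fun t => z * t `^ (z - 1)) _ _ ab.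
have -> : (\int[mu]_(x in `[n.+1%:R^-1%R, n.+2%:R]) (- expR (- x) * x `^ z)%:E =
    - (\int[mu]_(x in gamma_itv n) (x `^ z * expR (- x))%:E))%E.
  rewrite -integral_ge0N.
    by apply: eq_integral => x _; rewrite mulNr mulrC EFinN.
  by move=> x _; rewrite lee_fin mulr_ge0 ?powR_ge0 ?expR_ge0.
have -> : (\int[mu]_(x in `[n.+1%:R^-1%R, n.+2%:R])
      (expR (- x) * (z * x `^ (z - 1)))%:E =
    z%:E * \int[mu]_(x in gamma_itv n) (x `^ (z - 1) * expR (- x))%:E)%E.
  rewrite -ge0_integralZl_EFin//.
  - by apply: eq_integral => x _; rewrite mulrCA -EFinM (mulrC (expR _)).
  - exact: measurable_itv.
  - by move=> x _; rewrite lee_fin mulr_ge0 ?powR_ge0 ?expR_ge0.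
  - by apply/measurable_EFinP; exact: measurable_gamma_integrand.
  - exact: ltW.
rewrite oppeK !(mulrC (expR _)); apply.
- apply: continuous_subspaceT => x; apply: cvgN; exact: cexp.
- split => [x _||]; first by case: (dexp x).
  + by apply: cvg_at_right_filter; exact: cexp.
  + by apply: cvg_at_left_filter; exact: cexp.
- by move=> x _; rewrite derive1E; case: (dexp x).
- apply: continuous_in_subspaceT => x; rewrite inE/= in_itv/= => /andP[x1 _].
  apply: cvgM; first exact: cvg_cst.
  by apply: cpow; exact: lt_le_trans x1.
- split => [x||].
  + rewrite in_itv/= => /andP[x1 _].
    by have /= := is_derive1_powR z (lt_trans a0 x1); case.
  + by apply: cvg_at_right_filter; exact: cpow.
  + by apply: cvg_at_left_filter; exact: cpow.
- move=> x; rewrite in_itv/= => /andP[x1 _]; rewrite derive1E.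
  by have /= := is_derive1_powR z (lt_trans a0 x1); case.
Qed.

Lemma fine_pmull (z : R) (J : \bar R) : 0 < z -> fine (z%:E * J)%E = z * fine J.
Proof.
move=> z0; case: J => [r| |]; first by [].
- by rewrite mulry gtr0_sg// mul1e /fine mulr0.
- by rewrite mulrNy gtr0_sg// mul1e /fine mulr0.
Qed.

(** The limit is taken in the extended reals by monotone convergence, so that
    the integrability of t^(z-1) exp (-t) never has to be established. *)
Lemma Gamma_integralS (z : R) : 0 < z ->
  Gamma_integral (z + 1) = z * Gamma_integral z.
Proof.
move=> z0; rewrite /Gamma_integral addrK /Rintegral.
pose J := (\int[mu]_(t in `]0%R, +oo[) (t `^ (z - 1) * expR (- t))%:E)%E.
pose I := (\int[mu]_(t in `]0%R, +oo[) (t `^ z * expR (- t))%:E)%E.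
suff e : I = (z%:E * J)%E by rewrite -/I -/J e; exact: fine_pmull.
have h1 : (z%:E * \int[mu]_(t in gamma_itv n) (t `^ (z - 1) * expR (- t))%:E
    @[n --> \oo] --> z%:E * J)%E.
  by apply: cvgeZl => //; exact: cvg_gamma_itv.
have h2 : (z%:E * \int[mu]_(t in gamma_itv n) (t `^ (z - 1) * expR (- t))%:E
    @[n --> \oo] --> I)%E.
  under eq_cvg do rewrite gamma_by_parts//.
  rewrite -[I]add0e.
  apply: cvgeD; [by [] | | exact: cvg_gamma_itv].
  apply: cvg_EFin; first by near=> n.
  rewrite -[X in _ --> X](subr0 (0 : R)); apply: cvgB.
    exact: cvg_gamma_upper.
  exact: cvg_gamma_lower.
exact: cvg_unique h2 h1.
Unshelve. all: by end_near. Qed.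

(** Increasing m by one multiplies numerator and denominator by the same
    positive factor y + m, by [Gamma_integralS]. *)
Lemma Gamma_eq (y : R) m : (Num.bound y <= m)%N ->
  Gamma y = Gamma_integral (y + m%:R) / pochhammer y m.
Proof.
move=> /subnK <-; elim: (m - _)%N => [//|d ->].
set e := (d + _)%N; rewrite addSn pochhammerSr -natr1 addrA.
have ym : 0 < y + e%:R.
  rewrite -[y]opprK addrC subr_gt0.
  by rewrite (lt_le_trans (unstable.ltrNbound _))// ler_nat leq_addl.
rewrite Gamma_integralS// [X in _ * _ / X]mulrC -mulf_div.
by rewrite divff ?gt_eqF// mul1r.
Qed.

Lemma GammaS (y : R) : y != 0 -> Gamma (y + 1) = y * Gamma y.
Proof.
move=> y0; pose m := maxn (Num.bound y) (Num.bound (y + 1)).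
rewrite (@Gamma_eq _ m) ?leq_maxr// (@Gamma_eq y m.+1); last first.
  by rewrite ltnW// ltnS leq_maxl.
rewrite pochhammerSl -natr1 -addrA (addrC 1).
by rewrite [RHS]mulrA -mulf_div divff// mul1r.
Qed.
End GammaRecurrence.

(** * The Hahn difference operator *)

Section HahnOperator.
Variable R : realType.
Implicit Types (alpha c N : R) (p f g : {poly R}).

HB.instance Definition _ (l : int) := GRing.RMorphism.copy
  (@shift_op R l) (comp_poly ('X + (l%:~R)%:P)).

Lemma shift_opX (l : int) : shift_op l 'X = 'X + l%:~R%:P :> {poly R}.
Proof. exact: comp_polyX. Qed.

Lemma shift_opX1 : shift_op 1 'X = 'X + 1 :> {poly R}.
Proof. by rewrite shift_opX. Qed.

Lemma shift_opXN1 : shift_op (-1) 'X = 'X - 1 :> {poly R}.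
Proof. by rewrite shift_opX mulrN1z polyCN. Qed.

Lemma shift_opC (l : int) (a : R) : shift_op l a%:P = a%:P.
Proof. exact: comp_polyC. Qed.

Lemma shift_opZ (l : int) (a : R) p : shift_op l (a *: p) = a *: shift_op l p.
Proof. exact: comp_polyZ. Qed.

Lemma shift_op0 p : shift_op 0 p = p.
Proof. by rewrite /shift_op addr0 comp_polyXr. Qed.

Lemma shift_opD (l m : int) p : shift_op l (shift_op m p) = shift_op (l + m) p.
Proof.
rewrite /shift_op -comp_polyA comp_polyD comp_polyX comp_polyC.
by rewrite intrD polyCD addrA.
Qed.

(** For the Hahn weight w one has hahn_up(x) w(x) = hahn_down(x+1) w(x+1),
    which makes [hahn_op] symmetric. *)
Definition hahn_up c N : {poly R} := ('X + c%:P) * ((N - 1)%:P - 'X).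

Definition hahn_down alpha : {poly R} := 'X * (alpha%:P - 'X).

Definition hahn_op alpha c N f : {poly R} :=
  hahn_up c N * (shift_op 1 f - f) - hahn_down alpha * (f - shift_op (-1) f).

(** On polynomials in N - 1 - x this plays the role of - t d/dt: it is diagonal
    in [desc_basis]. It is also the derivative of the Hahn operator in c, see
    [hahn_op_shiftc]. *)
Definition euler_op N f : {poly R} := ((N - 1)%:P - 'X) * (shift_op 1 f - f).

Fact hahn_op_is_linear alpha c N : linear (hahn_op alpha c N).
Proof.
move=> a f g; rewrite /hahn_op !rmorphD/= !shift_opZ -!mul_polyC; ring.
Qed.

HB.instance Definition _ alpha c N :=
  GRing.isLinear.Build R {poly R} {poly R} *:%R (hahn_op alpha c N)
    (hahn_op_is_linear alpha c N).

Fact euler_op_is_linear N : linear (euler_op N).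
Proof.
by move=> a f g; rewrite /euler_op !rmorphD/= !shift_opZ -!mul_polyC; ring.
Qed.

HB.instance Definition _ N :=
  GRing.isLinear.Build R {poly R} {poly R} *:%R (euler_op N)
    (euler_op_is_linear N).

Lemma hahn_op_shiftc alpha c N (d : R) f :
  hahn_op alpha (c + d) N f = hahn_op alpha c N f + d *: euler_op N f.
Proof. by rewrite /hahn_op /euler_op /hahn_up -mul_polyC polyCD; ring. Qed.

(** An operator that is lower bidiagonal in a basis has eigenvectors whose
    coordinates obey a one-step recurrence. *)
Lemma two_term_eigen (L : {linear {poly R} -> {poly R}}) (lam G co : nat -> R)
    (b : nat -> {poly R}) n :
  (forall j, L (b j) = - lam j *: b j + G j *: b j.-1) -> G 0%N = 0 ->
  (forall j, (j < n)%N -> co j.+1 * G j.+1 = (lam j - lam n) * co j) ->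
  let p := \sum_(j < n.+1) co j *: b j in L p = - lam n *: p.
Proof.
move=> Lb G0 coS p; rewrite /p linear_sum/=.
under eq_bigr do rewrite linearZ/= Lb scalerDr !scalerA.
rewrite big_split/= [X in _ + X]big_ord_recl/= G0 mulr0 scale0r add0r.
rewrite big_ord_recr/= scaler_sumr [in RHS]big_ord_recr/= scalerA.
rewrite addrAC [co n * _]mulrC; congr (_ + _).
rewrite -big_split/=; apply: eq_bigr => j _.
rewrite coS// !scalerA -scalerDl; congr (_ *: _); ring.
Qed.

(** A basis adapted to the zero x = N - 1 of [hahn_up]: the Hahn operator is
    bidiagonal in it for every c, with an off-diagonal part independent of c.
    Eigenpolynomials for c and c - 1 can thus be compared coordinate by
    coordinate. *)
Definition desc_basis N j : {poly R} := \prod_(i < j) ((N - 1 - i%:R)%:P - 'X).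

Lemma desc_basisS N j :
  desc_basis N j.+1 = desc_basis N j * ((N - 1 - j%:R)%:P - 'X).
Proof. by rewrite /desc_basis big_ord_recr. Qed.

Lemma size_desc_basis N j : size (desc_basis N j) = j.+1.
Proof.
elim: j => [|j IH]; first by rewrite /desc_basis big_ord0 size_poly1.
rewrite desc_basisS -opprB mulrN size_polyN size_mul ?polyXsubC_eq0//.
  by rewrite IH size_XsubC addn2.
by rewrite -size_poly_gt0 IH.
Qed.

Lemma shift1_desc_basis N j :
  ((N - 1)%:P - 'X) * shift_op 1 (desc_basis N j) = desc_basis N j.+1.
Proof.
rewrite /desc_basis rmorph_prod big_ord_recl/= subr0; congr (_ * _).
apply: eq_bigr => i _; rewrite rmorphB/= shift_opX1 shift_opC /bump/= natrD.
by rewrite !rmorphB !rmorphD/=; ring.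
Qed.

Lemma shiftN1_desc_basis N j :
  shift_op (-1) (desc_basis N j.+1) = (N%:P - 'X) * desc_basis N j.
Proof.
rewrite /desc_basis rmorph_prod big_ord_recl/=; congr (_ * _).
  by rewrite rmorphB/= shift_opXN1 shift_opC !rmorphB/=; ring.
apply: eq_bigr => i _; rewrite rmorphB/= shift_opXN1 shift_opC /bump/= natrD.
by rewrite !rmorphB !rmorphD/=; ring.
Qed.

Lemma euler_desc_basis N j :
  euler_op N (desc_basis N j) = - j%:R *: desc_basis N j.
Proof.
rewrite /euler_op mulrBr shift1_desc_basis desc_basisS -mul_polyC.
by rewrite !rmorphB/= rmorphN/=; ring.
Qed.

Definition lowering_coef alpha N (j : nat) : R :=
  - (j%:R * (N - j%:R) * (N - j%:R - alpha)).

Lemma hahn_desc_basis alpha c N j :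
  hahn_op alpha c N (desc_basis N j) =
  - (j%:R * (j%:R + (alpha + c - N))) *: desc_basis N j
  + lowering_coef alpha N j *: desc_basis N j.-1.
Proof.
rewrite /hahn_op [X in X - _]
  (_ : _ = ('X + c%:P) * euler_op N (desc_basis N j)); last first.
  by rewrite /hahn_up /euler_op; ring.
rewrite euler_desc_basis; case: j => [|j].
  rewrite /lowering_coef !mul0r !oppr0 !scale0r /desc_basis big_ord0.
  by rewrite rmorph1 subrr !mulr0 subrr add0r.
rewrite shiftN1_desc_basis desc_basisS /lowering_coef -!mul_polyC /hahn_down /=.
by rewrite !(rmorphB, rmorphD, rmorphN, rmorphM)/= -natr1 !rmorphD/=; ring.
Qed.

End HahnOperator.

(** * Eigenpolynomials of the Hahn operator *)

Section Eigen.
Variable R : realType.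
Variables (alpha c N : R).
Local Notation a := (alpha + c - N).
Hypothesis a_neq : forall m, a + m.+1%:R != 0.

Definition eigen_coef (n m : nat) : R :=
  \prod_(m <= s < n)
    (- lowering_coef alpha N s.+1 / ((n%:R - s%:R) * (n%:R + s%:R + a))).

Definition hahn_eigen (n : nat) : {poly R} :=
  \sum_(m < n.+1) eigen_coef n m *: desc_basis N m.

Lemma eigen_coef_diag n : eigen_coef n n = 1.
Proof. by rewrite /eigen_coef big_geq. Qed.

Lemma subr_nat_neq0 n m : (m < n)%N -> n%:R - m%:R != 0 :> R.
Proof. by move=> mn; rewrite subr_eq0 eqr_nat gtn_eqF. Qed.

Lemma addr_nat_neq0 n : (0 < n)%N -> n%:R + (alpha + c - N) != 0.
Proof. by case: n => // n _; rewrite addrC a_neq. Qed.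

Lemma eigen_coefS n m : (m < n)%N ->
  eigen_coef n m * ((n%:R - m%:R) * (n%:R + m%:R + a))
  = - lowering_coef alpha N m.+1 * eigen_coef n m.+1.
Proof.
move=> mn; rewrite /eigen_coef big_ltn// mulrAC mulfVK//.
rewrite mulf_neq0 ?subr_nat_neq0// -natrD addr_nat_neq0//.
by rewrite ltn_addr// (leq_ltn_trans _ mn).
Qed.

Lemma hahn_eigenP n :
  hahn_op alpha c N (hahn_eigen n) =
  - (n%:R * (n%:R + a)) *: hahn_eigen n.
Proof.
apply: (two_term_eigen (L := hahn_op alpha c N)
  (lam := fun j => j%:R * (j%:R + a)) (@hahn_desc_basis R alpha c N)).
  by rewrite /lowering_coef !mul0r oppr0.
move=> j jn; rewrite mulrC -[LHS]opprK -mulNr -eigen_coefS//; ring.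
Qed.

Lemma size_hahn_eigen n : size (hahn_eigen n) = n.+1.
Proof.
rewrite /hahn_eigen big_ord_recr/= eigen_coef_diag scale1r addrC.
rewrite size_polyDl size_desc_basis// ltnS.
apply: (leq_trans (size_sum _ _ _)); apply/bigmax_leqP => i _.
by rewrite (leq_trans (size_scale_leq _ _))// size_desc_basis.
Qed.

(** Both sides obey the same recurrence in m, given by [eigen_coefS]; hence a
    descending induction from the diagonal m = n. *)
Lemma eigen_coef_contiguous n m : (m <= n)%N ->
  (n.+1%:R - m%:R) * (n.*2%:R + a) * (n.*2.+1%:R + a) * eigen_coef n.+1 m
  = - (n%:R + m%:R + a) * lowering_coef alpha N n.+1 * eigen_coef n m.
Proof.
move=> /subnK <-; move: (n - m)%N => d; elim: d m => {n} [|d IH] m.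
  rewrite add0n eigen_coef_diag; have := eigen_coefS (ltnSn m).
  rewrite eigen_coef_diag -muln2 natrM -!natr1 => h.
  rewrite !mulNr mulr1 [X in _ = - (_ * X)]
    (_ : _ = - (- lowering_coef alpha N m.+1 * 1)); last by ring.
  by rewrite -h natrM; ring.
have := IH m.+1; rewrite -addSnnS => IH'.
set n := (d.+1 + m)%N in IH' *.
have mn : (m < n)%N by rewrite /n addSn ltnS leq_addl.
have h1 := eigen_coefS (leqW mn : (m < n.+1)%N); have h2 := eigen_coefS mn.
have nz : (n%:R - m%:R) * (n.+1%:R + m%:R + a) != 0 :> R.
  by rewrite mulf_neq0 ?subr_nat_neq0// -natrD addr_nat_neq0.
apply: (mulIf nz).
transitivity ((n%:R - m%:R) * (n.*2%:R + a) * (n.*2.+1%:R + a)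
     * (eigen_coef n.+1 m * ((n.+1%:R - m%:R) * (n.+1%:R + m%:R + a)))).
  by ring.
rewrite h1.
transitivity (- (n.+1%:R + m%:R + a) * lowering_coef alpha N n.+1
     * (eigen_coef n m * ((n%:R - m%:R) * (n%:R + m%:R + a)))); last by ring.
rewrite h2.
transitivity (- lowering_coef alpha N m.+1 * ((n.+1%:R - m.+1%:R)
    * (n.*2%:R + a) * (n.*2.+1%:R + a) * eigen_coef n.+1 m.+1)).
  by rewrite -!natr1; ring.
by rewrite IH' -!natr1; ring.
Qed.

(** The eigenpolynomial of degree n + 1 for the parameter c - 1, multiplied by
    2n + a: this keeps it defined when a = 0 and n = 0, where it loses its
    leading term. *)
Definition lowered_eigen (n : nat) : {poly R} :=
  (n.*2%:R + a) *: hahn_eigen n.+1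
  - (lowering_coef alpha N n.+1 / (n.*2.+1%:R + a)) *: hahn_eigen n.

Lemma euler_hahn_eigen n : euler_op N (hahn_eigen n) =
  \sum_(m < n.+1) (eigen_coef n m * - m%:R) *: desc_basis N m.
Proof.
rewrite /hahn_eigen linear_sum; apply: eq_bigr => m _.
by rewrite linearZ/= euler_desc_basis scalerA.
Qed.

(** In each coordinate this is [eigen_coef_contiguous]. *)
Lemma euler_lowered_eigen n :
  euler_op N (lowered_eigen n) =
  - (n.+1%:R * (n.*2%:R + a)) *: hahn_eigen n.+1
  - (n%:R + a) * (lowering_coef alpha N n.+1 / (n.*2.+1%:R + a)) *: hahn_eigen n.
Proof.
have nz : n.*2.+1%:R + a != 0 by rewrite addr_nat_neq0.
rewrite /lowered_eigen [LHS]linearB [euler_op _ _ - _]/=.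
rewrite !(linearZ_LR (euler_op N)) /= !euler_hahn_eigen /hahn_eigen.
rewrite ![\sum_(i < n.+2) _]big_ord_recr/= !eigen_coef_diag !mul1r scale1r.
set u := n.*2%:R + a; set v := lowering_coef _ _ _ / _; set w := - (_ * u).
rewrite ![_ *: (_ + _)]scalerDr addrAC [RHS]addrAC; congr (_ + _); last first.
  by rewrite scalerA; congr (_ *: _); rewrite /w; ring.
rewrite !scaler_sumr -!sumrB; apply: eq_bigr => i _.
rewrite !scalerA -!scalerBl; congr (_ *: _).
have := eigen_coef_contiguous (ltnSE (ltn_ord i)).
set x := eigen_coef n.+1 i; set y := eigen_coef n i => h.
apply: (mulIf nz); apply/eqP; rewrite -subr_eq0; apply/eqP.
transitivity ((n.+1%:R - i%:R) * (n.*2%:R + a) * (n.*2.+1%:R + a) * x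
    + (n%:R + i%:R + a) * lowering_coef alpha N n.+1 * y).
  by rewrite /w /v /u; field; rewrite nat1r.
by rewrite h; ring.
Qed.

Lemma lowered_eigenP n :
  hahn_op alpha (c - 1) N (lowered_eigen n) =
  - (n.+1%:R * (n%:R + a)) *: lowered_eigen n.
Proof.
rewrite hahn_op_shiftc euler_lowered_eigen /lowered_eigen linearB !linearZ/=.
rewrite !hahn_eigenP -!mul_polyC -!natr1 -muln2 natrM -natr1.
rewrite !(rmorphB, rmorphD, rmorphN, rmorphM)/=; ring.
Qed.

End Eigen.

(** * Functionals satisfying the Pearson equation *)

Section Pearson.
Variable R : realType.
Implicit Types (alpha c N : R) (f g : {poly R}) (mu : {scalar {poly R}}).

Lemma functionalZ mu (x : R) f : mu (x *: f) = x * mu f.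
Proof. exact: linearZ. Qed.

Lemma mul_functionalE (r : {poly R}) mu f : mul_functional r mu f = mu (r * f).
Proof. by []. Qed.

(** A family with one polynomial in each degree below n spans the polynomials
    of degree less than n. *)
Lemma scalar_eq0_span (phi : {poly R} -> R) (b : nat -> {poly R}) n :
  scalar phi -> (forall j, (j < n)%N -> size (b j) = j.+1) ->
  (forall j, (j < n)%N -> phi (b j) = 0) ->
  forall f, (size f <= n)%N -> phi f = 0.
Proof.
move=> phiL.
have phiD x f g : phi (x *: f + g) = x * phi f + phi g by exact: phiL.
have phi0 : phi 0 = 0.
  by have := phiD (-1) 0 0; rewrite scaler0 addr0 mulN1r addNr.
elim: n => [|n IH] sb b0 f sf.
  by move: sf; rewrite leqn0 size_poly_eq0 => /eqP ->.
(* Cancel the coefficient of degree n with b n. *)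
pose x := f`_n / lead_coef (b n).
have lb : lead_coef (b n) != 0.
  by rewrite lead_coef_eq0 -size_poly_gt0 sb.
rewrite (_ : f = x *: b n + (f - x *: b n)); last by rewrite addrC subrK.
rewrite phiD b0// mulr0 add0r; apply: IH => [j jn|j jn|].
- by rewrite sb// ltnW.
- by rewrite b0// ltnW.
- apply/leq_sizeP => i; rewrite leq_eqVlt => /predU1P[<-|ni].
    have e : lead_coef (b n) = (b n)`_n by rewrite lead_coefE sb.
    by rewrite coefB coefZ -e divfK ?subrr.
  rewrite coefB coefZ nth_default ?(leq_trans sf)//.
  by rewrite nth_default ?mulr0 ?subr0// sb.
Qed.

(** Summation by parts against the weight, in the form available for an
    arbitrary functional. *)
Definition pearson alpha c N mu := forall g,
  mu (hahn_up c N * g) = mu (hahn_down alpha * shift_op (-1) g).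

Lemma shiftN1_shift1 f : shift_op (-1) (shift_op 1 f) = f.
Proof. by rewrite shift_opD addNr shift_op0. Qed.

(** The Pearson equation for g = Delta f. *)
Lemma pearson_hahn_op alpha c N mu f :
  pearson alpha c N mu -> mu (hahn_op alpha c N f) = 0.
Proof.
move=> pmu; rewrite /hahn_op linearB/= pmu -linearB/=.
by rewrite rmorphB/= shiftN1_shift1 subrr linear0.
Qed.

(** The difference of both sides is the Pearson equation for the discrete
    Wronskian f(x+1) g(x) - f(x) g(x+1). *)
Lemma pearson_hahn_sym alpha c N mu f g : pearson alpha c N mu ->
  mu (hahn_op alpha c N f * g) = mu (f * hahn_op alpha c N g).
Proof.
move=> pmu; apply/eqP; rewrite -subr_eq0 -linearB/=; apply/eqP.
pose w := shift_op 1 f * g - f * shift_op 1 g.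
have -> : hahn_op alpha c N f * g - f * hahn_op alpha c N g =
    hahn_up c N * w - hahn_down alpha * shift_op (-1) w.
  by rewrite /w rmorphB !rmorphM/= !shiftN1_shift1 /hahn_op; ring.
by rewrite linearB/= pmu subrr.
Qed.

Definition rising_poly c i : {poly R} := \prod_(l < i) ('X + (c + l%:R)%:P).

Lemma rising_polyS c i :
  rising_poly c i.+1 = rising_poly c i * ('X + (c + i%:R)%:P).
Proof. by rewrite /rising_poly big_ord_recr. Qed.

Lemma rising_polySl c i :
  rising_poly c i.+1 = ('X + c%:P) * rising_poly (c + 1) i.
Proof.
rewrite /rising_poly big_ord_recl addr0; congr (_ * _); apply: eq_bigr => l _.
by rewrite lift0 -natr1 -addrA (addrC 1).
Qed.

Lemma shiftN1_rising_poly c i :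
  shift_op (-1) (rising_poly (c + 1) i) = rising_poly c i.
Proof.
rewrite /rising_poly rmorph_prod; apply: eq_bigr => l _.
by rewrite rmorphD/= shift_opXN1 shift_opC !rmorphD/=; ring.
Qed.

(** Multiplying the weight by (x+c)...(x+c+i-1) turns Gamma (x+c) into Gamma
    (x+c+i), that is, c into c+i. *)
Lemma pearson_rising alpha c N mu i : pearson alpha c N mu ->
  pearson alpha (c + i%:R) N (mul_functional (rising_poly c i) mu).
Proof.
move=> pmu g; rewrite !mul_functionalE.
rewrite [X in mu X](_ : _ = hahn_up c N * (rising_poly (c + 1) i * g)).
  by rewrite pmu rmorphM/= shiftN1_rising_poly mulrCA.
rewrite /hahn_up; transitivity (rising_poly c i.+1 * ((N - 1)%:P - 'X) * g).
  by rewrite rising_polyS; ring.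
by rewrite rising_polySl; ring.
Qed.

(** Eigenvectors of a symmetric operator for distinct eigenvalues: for j < n
    the difference of eigenvalues is (n-j) (n+j+a), where n + j >= 1. *)
Lemma hahn_eigen_orthogonal alpha c N mu n g :
  (forall m, alpha + c - N + m.+1%:R != 0) -> pearson alpha c N mu ->
  (size g <= n)%N -> mu (hahn_eigen alpha c N n * g) = 0.
Proof.
move=> a_neq pmu; rewrite -mul_functionalE.
apply: (scalar_eq0_span (b := hahn_eigen alpha c N)) => [|j jn|j jn].
- by move=> x f1 f2; rewrite linearP.
- exact: size_hahn_eigen.
- rewrite mul_functionalE.
  have := pearson_hahn_sym (hahn_eigen alpha c N n) (hahn_eigen alpha c N j)
    pmu.
  rewrite !hahn_eigenP// -scalerAl -scalerAr !functionalZ => /eqP.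
  rewrite -subr_eq0 -mulrBl mulf_eq0 => /orP[|/eqP //].
  rewrite (_ : _ - _ =
    - ((n%:R - j%:R) * ((n + j)%:R + (alpha + c - N)))); last first.
    by rewrite natrD; ring.
  rewrite oppr_eq0 mulf_eq0 (negbTE (subr_nat_neq0 _ jn)) /= => /eqP h.
  have nj0 : (0 < n + j)%N by rewrite ltn_addr// (leq_ltn_trans _ jn).
  by have := addr_nat_neq0 a_neq nj0; rewrite h eqxx.
Qed.

End Pearson.

(** * The Pearson equation of the Hahn functional *)

Section HahnPearson.
Variable R : realType.
Implicit Types (alpha c N : R) (f g : {poly R}) (mu : {scalar {poly R}}).

Local Notation eps := (pochhammer (- 'X : {poly R})).

Lemma shift1_pochhammerX j : shift_op 1 (eps j.+1) = (- 'X - 1) * eps j.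
Proof.
rewrite pochhammerSl rmorphM/= rmorphN/= shift_opX1 opprD; congr (_ * _).
rewrite /pochhammer rmorph_prod; apply: eq_bigr => i _.
by rewrite !rmorphD rmorphN/= shift_opX1 rmorph1 rmorph_nat; ring.
Qed.

Lemma shiftN1_pochhammerX j : - 'X * shift_op (-1) (eps j) = eps j.+1.
Proof.
rewrite pochhammerSl; congr (_ * _).
rewrite /pochhammer rmorph_prod; apply: eq_bigr => i _.
by rewrite !rmorphD rmorphN/= shift_opXN1 rmorph_nat; ring.
Qed.

Lemma hahn_op_pochhammerX alpha c N j :
  hahn_op alpha c N (eps j) =
  - (j%:R * (j%:R + (alpha + c - N))) *: eps j
  + (- (j%:R * (c + j%:R - 1) * (N - j%:R))) *: eps j.-1.
Proof.
rewrite /hahn_op [X in _ - X](_ : _ = j%:R * (alpha%:P - 'X) * eps j);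
  last first.
  transitivity ((alpha%:P - 'X) * ('X * eps j + - 'X * shift_op (-1) (eps j))).
    by rewrite /hahn_down; ring.
  by rewrite shiftN1_pochhammerX pochhammerSr; ring.
case: j => [|j].
  rewrite !mul0r !oppr0 !scale0r /pochhammer big_ord0.
  by rewrite rmorph1; ring.
rewrite shift1_pochhammerX pochhammerSr -!mul_polyC /hahn_up /= -!natr1.
rewrite !(rmorphB, rmorphD, rmorphN, rmorphM)/= rmorph_nat; ring.
Qed.

(** In the basis (-x)_j the Hahn operator is bidiagonal, and the coefficients
    of the Hahn polynomial obey the recurrence required by [two_term_eigen]. *)
Lemma hahn_op_hahn_poly alpha c N n :
  ~ nonpositive_integer (alpha + c - N + 1) ->
  hahn_op alpha c N (hahn_poly alpha c N n) =
  - (n%:R * (n%:R + (alpha + c - N))) *: hahn_poly alpha c N n.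
Proof.
move=> a_np; pose co j := pochhammer (- n%:R : R) j
  * pochhammer (1 - N + j%:R) (n - j) * pochhammer (c + j%:R) (n - j)
  / (pochhammer (n%:R + alpha + c - N + j%:R) (n - j) * j`!%:R).
pose lam j : R := j%:R * (j%:R + (alpha + c - N)).
pose G j : R := - (j%:R * (c + j%:R - 1) * (N - j%:R)).
apply: (@two_term_eigen _ (hahn_op alpha c N) lam G co (pochhammer (- 'X))).
- exact: hahn_op_pochhammerX.
- by rewrite /G !mul0r oppr0.
rewrite /lam /G /co => {lam G co}.
move=> j jn.
have nj : (n - j)%N = (n - j.+1).+1 by rewrite subnSK.
rewrite nj; set m := (n - j.+1)%N.
rewrite ![pochhammer _ m.+1]pochhammerSl pochhammerSr factS natrM.
have -> : (n%:R + alpha + c - N + j.+1%:R) = n%:R + alpha + c - N + j%:R + 1.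
  by rewrite -natr1 addrA.
have -> : (1 - N + j.+1%:R) = 1 - N + j%:R + 1 by rewrite -natr1 addrA.
have -> : (c + j.+1%:R) = c + j%:R + 1 by rewrite -natr1 addrA.
have a_nz l : n%:R + alpha + c - N + j%:R + l%:R != 0.
  apply/eqP => h; apply: a_np; exists (n.-1 + j + l)%N.
  apply/eqP; rewrite -addr_eq0 -h !natrD; apply/eqP.
  by rewrite -[in RHS](ltn_predK (leq_ltn_trans (leq0n _) jn)) -natr1; ring.
have pz : pochhammer (n%:R + alpha + c - N + j%:R + 1) m != 0.
  apply/prodf_neq0 => l _; have := a_nz l.+1.
  by rewrite -natr1 addrA addrAC.
have a_nz0 := a_nz 0%N; rewrite addr0 in a_nz0.
have fz : j`!%:R != 0 :> R by rewrite pnatr_eq0 gtn_eqF ?fact_gt0.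
have jz : j.+1%:R != 0 :> R by rewrite pnatr_eq0.
move: (pochhammer _ m) (pochhammer (c + _ + _) m)
  (pochhammer (n%:R + _ + _ - _ + _ + _) m) pz => x y z zz.
move: (j`!%:R) fz => w wz.
rewrite -!natr1 in jz *; field.
by rewrite wz zz a_nz0 jz.
Qed.

(** Orthogonality to 1 kills every Hahn polynomial of positive degree, and the
    Hahn operator kills constants; so mu vanishes on the range of the operator.
    This is the Pearson equation for differences g = Delta f, and every
    polynomial is one. *)
Lemma pearson_orthogonal_hahn alpha c N mu :
  ~ nonpositive_integer (alpha + c - N + 1) ->
  orthogonal_family mu predT (hahn_poly alpha c N) -> pearson alpha c N mu.
Proof.
move=> a_np omu.
have Lmu f : mu (hahn_op alpha c N f) = 0.
  apply: (scalar_eq0_span (phi := fun f => mu (hahn_op alpha c N f))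
    (b := hahn_poly alpha c N) (n := size f)) => // [x f1 f2|j _|j _].
  - by rewrite !linearP.
  - by have [] := omu j isT.
  - rewrite hahn_op_hahn_poly// functionalZ; case: j => [|j].
      by rewrite mul0r oppr0 mul0r.
    have [_ /(_ 0%N isT) h _] := omu j.+1 isT.
    by rewrite expr0 mulr1 in h; rewrite h mulr0.
move=> g; apply/eqP; rewrite -subr_eq0 -linearB/=; apply/eqP.
apply: (scalar_eq0_span
    (phi := fun g => mu (hahn_up c N * g - hahn_down alpha * shift_op (-1) g))
    (b := desc_basis (N - 1)) (n := size g)) => // [x f1 f2|j _|j _].
- rewrite rmorphD/= shift_opZ -functionalZ -linearD/=; congr (mu _).
  by rewrite -!mul_polyC; ring.
- exact: size_desc_basis.
have e : shift_op 1 (desc_basis N j.+1) - desc_basis N j.+1 =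
    - j.+1%:R *: desc_basis (N - 1) j.
  have nz : (N - 1)%:P - 'X != 0 :> {poly R}.
    by rewrite -opprB oppr_eq0 polyXsubC_eq0.
  apply: (mulfI nz); rewrite -[LHS]/(euler_op N _) euler_desc_basis -scalerAr.
  congr (_ *: _).
  rewrite /desc_basis big_ord_recl subr0; congr (_ * _); apply: eq_bigr => i _.
  by rewrite lift0 -natr1; congr (_%:P - _); ring.
have := Lmu (desc_basis N j.+1); rewrite /hahn_op e.
have -> : desc_basis N j.+1 - shift_op (-1) (desc_basis N j.+1)
   = - j.+1%:R *: shift_op (-1) (desc_basis (N - 1) j).
  by rewrite -shift_opZ -e rmorphB/= shiftN1_shift1.
rewrite -!scalerAr -scalerBr functionalZ => /eqP.
by rewrite mulf_eq0 oppr_eq0 pnatr_eq0/= => /eqP.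
Qed.

(** Termwise, the functional equation of Gamma relates the weights at i and
    i+1; the boundary terms vanish because [hahn_up] has the root N - 1 and
    [hahn_down] the root 0. *)
Lemma pearson_hahn_measure alpha c (M : nat) mu :
  ~ nonpositive_integer (alpha - M%:R + 1) -> ~ nonpositive_integer c ->
  (forall p : {poly R}, mu p = Gamma M%:R * \sum_(x < M)
      Gamma (alpha - x%:R) * Gamma (x%:R + c)
        / (Gamma (M%:R - x%:R) * x`!%:R) * p.[x%:R]) ->
  pearson alpha c M%:R mu.
Proof.
case: M => [|M] al_np c_np mE g.
  by rewrite !mE !big_ord0.
rewrite !mE big_ord_recr [in RHS]big_ord_recl/=; congr (_ * _).
rewrite /hahn_up /hahn_down !hornerM !hornerD !hornerN !hornerX !hornerC.
have -> : M.+1%:R - 1 - M%:R = 0 :> R by rewrite -natr1; ring.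
rewrite !(mulr0, mul0r) addr0 add0r.
apply: eq_bigr => i _; rewrite /bump/= add1n.
rewrite !hornerM !hornerD !hornerN !hornerX !hornerC /shift_op horner_comp.
rewrite !hornerD hornerX hornerC mulrN1z.
have -> : i.+1%:R - 1 = i%:R :> R by rewrite -natr1 addrK.
have hc : i%:R + c != 0.
  by apply/eqP => h; apply: c_np; exists i; apply/eqP; rewrite -addr_eq0 addrC h.
have hM : M.+1%:R - i.+1%:R != 0 :> R.
  by rewrite subr_eq0 eqr_nat eqSS gtn_eqF.
have ha : alpha - i.+1%:R != 0.
  apply/eqP => h; apply: al_np; exists (M - i.+1)%N.
  apply/eqP; rewrite -addr_eq0 natrB// -!natr1; apply/eqP.
  by rewrite -[RHS]h -natr1; ring.
have e1 : Gamma (alpha - i%:R) = (alpha - i.+1%:R) * Gamma (alpha - i.+1%:R).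
  by rewrite -GammaS//; congr Gamma; rewrite -natr1; ring.
have e2 : Gamma (i.+1%:R + c) = (i%:R + c) * Gamma (i%:R + c).
  by rewrite -GammaS//; congr Gamma; rewrite -natr1; ring.
have e3 : Gamma (M.+1%:R - i%:R) =
    (M.+1%:R - i.+1%:R) * Gamma (M.+1%:R - i.+1%:R) :> R.
  by rewrite -GammaS//; congr Gamma; rewrite -!natr1; ring.
rewrite e1 e2 e3 factS natrM {e1 e2 e3}.
move: (Gamma (alpha - i.+1%:R)) (Gamma (i%:R + c)) (Gamma (M.+1%:R - i.+1%:R)).
move=> g1 g2 g3; rewrite !invfM.
have iz : i.+1%:R != 0 :> R by rewrite pnatr_eq0.
set w := (i`!%:R)^-1; set y := g.[_].
have -> : M.+1%:R - 1 - i%:R = M.+1%:R - i.+1%:R :> R.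
  by rewrite -[in RHS](natr1 i); ring.
transitivity (g1 * g2 / g3 * w * y * (i%:R + c) * (alpha - i.+1%:R)
   * ((M.+1%:R - i.+1%:R) / (M.+1%:R - i.+1%:R))); first by ring.
rewrite divff//.
transitivity (g1 * g2 / g3 * w * y * (i%:R + c) * (alpha - i.+1%:R)
   * (i.+1%:R / i.+1%:R)); last by ring.
by rewrite divff.
Qed.

Lemma pearson_hahn alpha c N mu :
  ~ nonpositive_integer (alpha - N + 1) -> ~ nonpositive_integer c ->
  hahn_functional alpha c N mu -> pearson alpha c N mu.
Proof.
move=> al_np c_np [[_ [a_np _ _ _] omu _]|[M [_ NM mE]]].
  exact: pearson_orthogonal_hahn.
by rewrite NM in al_np mE *; exact: pearson_hahn_measure.
Qed.

End HahnPearson.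

(** * The difference operator and its eigenpolynomials *)

Section KrallOperator.
Variable R : realType.
Variables (alpha c N : R).
Local Notation a := (alpha + c - N).
Local Notation L := (hahn_op alpha c N).

(** On the eigenvalue n (n+a) of - L this is (n+s) (n+a-s), a factor of the
    dual Hahn polynomial. *)
Definition hahn_factor (s : nat) (f : {poly R}) : {poly R} :=
  - L f + (s%:R * (a - s%:R)) *: f.

Fact hahn_factor_is_linear s : linear (hahn_factor s).
Proof.
move=> b f g; rewrite /hahn_factor linearP/= -!mul_polyC; ring.
Qed.

HB.instance Definition _ s :=
  GRing.isLinear.Build R {poly R} {poly R} *:%R (hahn_factor s)
    (hahn_factor_is_linear s).

Fixpoint hahn_factors (j : nat) (f : {poly R}) : {poly R} :=
  if j is i.+1 then hahn_factor j (hahn_factors i f) else f.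

Fact hahn_factors_is_linear j : linear (hahn_factors j).
Proof. by move=> b f g; elim: j => //= j ->; rewrite linearP. Qed.

HB.instance Definition _ j :=
  GRing.isLinear.Build R {poly R} {poly R} *:%R (hahn_factors j)
    (hahn_factors_is_linear j).

Lemma hahn_factorC s t f :
  hahn_factor s (hahn_factor t f) = hahn_factor t (hahn_factor s f).
Proof.
rewrite /hahn_factor !(linearD L) !(linearN L) !(linearZ_LR L)/=.
rewrite -!mul_polyC; ring.
Qed.

Lemma hahn_factorsS j f :
  hahn_factors j.+1 f = hahn_factors j (hahn_factor j.+1 f).
Proof.
rewrite /=; elim: j (j.+1) => //= j IH s.
by rewrite -IH hahn_factorC.
Qed.

Variables (k : nat) (d : nat -> R).

(** The operator Y of the introduction, for arbitrary coefficients d_j. *)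
Definition krall_sum (f : {poly R}) : {poly R} :=
  \sum_(j < k.+1) d j *: hahn_factors j f.

(** The operator D of the introduction, for arbitrary coefficients d_j. *)
Definition krall_op (f : {poly R}) : {poly R} :=
  \sum_(j < k.+1) d j *: (euler_op N (hahn_factors j f)
                          - j.+1%:R^-1 *: L (hahn_factors j f)).

(** The number h_n of the introduction; see [krall_weightE]. *)
Definition krall_weight (n : nat) : R :=
  \sum_(j < k.+1) d j * \prod_(i < j) ((n%:R + i%:R) * (n%:R + a - 2 - i%:R)).

(** A discrete antiderivative of (2n+a-2) [krall_weight] n; what matters below
    are its two expressions through [krall_tail]. *)
Definition krall_eigenvalue (n : nat) : R :=
  \sum_(j < k.+1) d j / j.+1%:R
    * \prod_(i < j.+1) ((n%:R + i%:R) * (n%:R + a - 1 - i%:R)).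

Lemma hahn_factors_eigen j n f :
  L f = - (n%:R * (n%:R + a)) *: f ->
  hahn_factors j f =
  (\prod_(i < j) ((n.+1%:R + i%:R) * (n.+1%:R + a - 2 - i%:R))) *: f.
Proof.
move=> Lf; elim: j => [|j IH]; first by rewrite big_ord0 scale1r.
rewrite /= IH linearZ/= big_ord_recr/= -scalerA; congr (_ *: _).
rewrite /hahn_factor Lf -scaleNr -scalerDl -!natr1; congr (_ *: _); ring.
Qed.

Lemma krall_sum_eigen n f : L f = - (n%:R * (n%:R + a)) *: f ->
  krall_sum f = krall_weight n.+1 *: f.
Proof.
move=> Lf; rewrite /krall_sum /krall_weight scaler_suml.
by apply: eq_bigr => j _; rewrite (hahn_factors_eigen j Lf) scalerA.
Qed.

Fact krall_sum_is_linear : linear krall_sum.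
Proof.
move=> b f g; rewrite /krall_sum scaler_sumr -big_split/=; apply: eq_bigr => j _.
by rewrite linearP/= -!mul_polyC; ring.
Qed.

HB.instance Definition _ :=
  GRing.isLinear.Build R {poly R} {poly R} *:%R krall_sum krall_sum_is_linear.

Fact krall_op_is_linear : linear krall_op.
Proof.
move=> b f g; rewrite /krall_op scaler_sumr -big_split/=; apply: eq_bigr => j _.
rewrite !linearP/= -!mul_polyC; ring.
Qed.

HB.instance Definition _ :=
  GRing.isLinear.Build R {poly R} {poly R} *:%R krall_op krall_op_is_linear.

(** The eigenvalue of sum_j d_j / (j+1) (- L) K_j on the n-th eigenpolynomial
    of L. *)
Definition krall_tail (n : nat) : R :=
  \sum_(j < k.+1) d j / j.+1%:R * (n%:R * (n%:R + a)
    * \prod_(i < j) ((n.+1%:R + i%:R) * (n.+1%:R + a - 2 - i%:R))).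

(** Termwise, lam_n = n (n+a-1-j) + n (j+1). *)
Lemma krall_tail_lower n :
  krall_tail n = krall_eigenvalue n + n%:R * krall_weight n.+1.
Proof.
rewrite /krall_tail /krall_weight /krall_eigenvalue mulr_sumr -big_split/=.
apply: eq_bigr => j _.
have -> : \prod_(i < j.+1) ((n%:R + i%:R) * (n%:R + a - 1 - i%:R)) =
    n%:R * (n%:R + a - 1 - j%:R)
    * \prod_(i < j) ((n.+1%:R + i%:R) * (n.+1%:R + a - 2 - i%:R)).
  rewrite !big_split/=.
  have -> : \prod_(i < j.+1) (n%:R + i%:R) =
      n%:R * \prod_(i < j) (n.+1%:R + i%:R) :> R.
    rewrite big_ord_recl addr0; congr (_ * _); apply: eq_bigr => i _.
    by rewrite lift0 -!natr1; ring.
  have -> : \prod_(i < j.+1) (n%:R + a - 1 - i%:R) =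
      \prod_(i < j) (n.+1%:R + a - 2 - i%:R) * (n%:R + a - 1 - j%:R).
    rewrite big_ord_recr/=; congr (_ * _); apply: eq_bigr => i _.
    by rewrite -natr1; ring.
  ring.
set P := \prod_(i < j) _.
have := pnatr_eq0 R j.+1; rewrite -natr1 => /negbT nz; field.
exact: nz.
Qed.

(** Termwise, lam_n = (n+1+j) (n+a) - (n+a) (j+1). *)
Lemma krall_tail_upper n :
  krall_tail n = krall_eigenvalue n.+1 - (n%:R + a) * krall_weight n.+1.
Proof.
rewrite /krall_tail /krall_weight /krall_eigenvalue mulr_sumr -sumrB/=.
apply: eq_bigr => j _.
have -> : \prod_(i < j.+1) ((n.+1%:R + i%:R) * (n.+1%:R + a - 1 - i%:R)) =
    (n.+1%:R + j%:R) * (n%:R + a)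
    * \prod_(i < j) ((n.+1%:R + i%:R) * (n.+1%:R + a - 2 - i%:R)).
  rewrite !big_split/=.
  have -> : \prod_(i < j.+1) (n.+1%:R + a - 1 - i%:R) =
      (n%:R + a) * \prod_(i < j) (n.+1%:R + a - 2 - i%:R).
    rewrite big_ord_recl subr0; congr (_ * _); first by rewrite -natr1; ring.
    by apply: eq_bigr => i _; rewrite lift0 -!natr1; ring.
  by rewrite big_ord_recr/=; ring.
set P := \prod_(i < j) _.
have := pnatr_eq0 R j.+1; rewrite -!natr1 => /negbT nz; field.
exact: nz.
Qed.

Lemma krall_op_eigen n f : L f = - (n%:R * (n%:R + a)) *: f ->
  krall_op f = krall_weight n.+1 *: euler_op N f + krall_tail n *: f.
Proof.
move=> Lf; rewrite /krall_op /krall_weight /krall_tail.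
rewrite !scaler_suml -big_split/=; apply: eq_bigr => j _.
rewrite (hahn_factors_eigen j Lf); set P := \prod_(i < j) _.
rewrite (linearZ_LR (euler_op N)) (linearZ_LR L)/= Lf.
rewrite -!mul_polyC !rmorphM/= rmorphN/= rmorphM/=; ring.
Qed.

(** The polynomial q_{n+1} of the introduction, with the same normalization as
    [lowered_eigen]. *)
Definition krall_poly (n : nat) : {poly R} :=
  (n.*2%:R + a) * krall_weight n.+1 *: hahn_eigen alpha c N n.+1
  - lowering_coef alpha N n.+1 / (n.*2.+1%:R + a) * krall_weight n.+2
    *: hahn_eigen alpha c N n.

Hypothesis a_neq : forall m, a + m.+1%:R != 0.

(** The weights are arranged so that Y gives both eigenpolynomials the same
    factor. *)
Lemma krall_sum_poly n :
  krall_sum (krall_poly n) =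
  krall_weight n.+1 * krall_weight n.+2 *: lowered_eigen alpha c N n.
Proof.
rewrite /krall_poly (linearB krall_sum) !(linearZ_LR krall_sum)/=.
rewrite !(krall_sum_eigen (hahn_eigenP a_neq _)) /lowered_eigen.
rewrite -!mul_polyC !rmorphM/=; ring.
Qed.

(** E maps [lowered_eigen] to a combination of the same two eigenpolynomials;
    the two coefficients of the result are matched by [krall_tail_lower] and
    [krall_tail_upper]. *)
Lemma krall_op_poly n :
  krall_op (krall_poly n) = krall_eigenvalue n.+1 *: krall_poly n.
Proof.
rewrite {1}/krall_poly (linearB krall_op) !(linearZ_LR krall_op)/=.
rewrite !(krall_op_eigen (hahn_eigenP a_neq _)).
set r1 := hahn_eigen _ _ _ n.+1; set r0 := hahn_eigen _ _ _ n.
set v := lowering_coef _ _ _ / _; set u := n.*2%:R + a.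
have E : u *: euler_op N r1 - v *: euler_op N r0 =
    - (n.+1%:R * u) *: r1 - (n%:R + a) * v *: r0.
  rewrite -(euler_lowered_eigen a_neq) /lowered_eigen.
  by rewrite (linearB (euler_op N)) !(linearZ_LR (euler_op N)).
transitivity (krall_weight n.+1 * krall_weight n.+2
     *: (u *: euler_op N r1 - v *: euler_op N r0)
   + u * krall_weight n.+1 * krall_tail n.+1 *: r1
   - v * krall_weight n.+2 * krall_tail n *: r0).
  rewrite -!mul_polyC !rmorphM/=; ring.
rewrite E krall_tail_lower krall_tail_upper /krall_poly -/u -/v -/r1 -/r0.
rewrite -!mul_polyC !(rmorphM, rmorphD, rmorphB, rmorphN)/=; ring.
Qed.

Lemma size_krall_poly n : n.*2%:R + a != 0 -> krall_weight n.+1 != 0 ->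
  size (krall_poly n) = n.+2.
Proof.
move=> nz wz; rewrite /krall_poly size_polyDl size_scale ?mulf_neq0//.
  exact: size_hahn_eigen.
rewrite size_polyN size_hahn_eigen ltnS.
by rewrite (leq_trans (size_scale_leq _ _))// size_hahn_eigen.
Qed.

End KrallOperator.

(** * The transformed functional *)

Section Christoffel.
Variable R : realType.
Implicit Types (alpha c N : R) (f g : {poly R}) (mu : {scalar {poly R}}).

(** Write L for the parameter c+1+j as the operator for c+1, which is killed by
    (x+c) mu, plus j E. The Pearson equation turns (x+c) E f into a multiple of
    f by hahn_down - hahn_up, which has degree one only. *)
Lemma pearson_factor alpha c N mu (j : nat) f : pearson alpha c N mu ->
  j%:R * (c * (alpha + c)) * mu f =
  mu (('X + c%:P) * hahn_factor alpha (c + 1 + j%:R) N j f).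
Proof.
move=> pmu; rewrite /hahn_factor hahn_op_shiftc.
have h0 : mu (('X + c%:P) * hahn_op alpha (c + 1) N f) = 0.
  have := pearson_hahn_op f (pearson_rising 1 pmu).
  by rewrite mul_functionalE rising_polyS /rising_poly big_ord0 mul1r addr0.
have h1 : mu (('X + c%:P) * euler_op N f) =
    (alpha + c - N + 1) * mu ('X * f) - c * (N - 1) * mu f.
  have -> : ('X + c%:P) * euler_op N f =
      hahn_up c N * shift_op 1 f - hahn_up c N * f.
    by rewrite /euler_op /hahn_up; ring.
  rewrite linearB/= pmu shiftN1_shift1 -linearB/= -!linearZ/= -linearB/=.
  congr (mu _); rewrite /hahn_down /hahn_up -!mul_polyC.
  by rewrite !(rmorphB, rmorphD, rmorphM)/=; ring.
set s := j%:R * (_ - _).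
have -> : ('X + c%:P)
    * (- (hahn_op alpha (c + 1) N f + j%:R *: euler_op N f) + s *: f) =
      - (('X + c%:P) * hahn_op alpha (c + 1) N f)
      - j%:R *: (('X + c%:P) * euler_op N f) + s *: ('X * f + c *: f).
  by rewrite -!mul_polyC; ring.
rewrite (linearD mu) (linearB mu) (linearN mu) h0 !functionalZ h1.
by rewrite (linearD mu) functionalZ /s; ring.
Qed.

(** Peel off the factors of K_j one after the other by [pearson_factor]; each
    of them lowers the number of factors (x+c+l) by one. *)
Lemma pearson_factors alpha c N mu (k i j : nat) f : pearson alpha c N mu ->
  (i + j)%N = k ->
  mu (rising_poly c k * hahn_factors alpha (c + k.+1%:R) N j f) =
  j`!%:R * (pochhammer (c + i%:R) j * pochhammer (alpha + c + i%:R) j)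
  * mu (rising_poly c i * f).
Proof.
move=> pmu; elim: j i f => [|j IH] i f ijk.
  by rewrite -ijk addn0 /= /pochhammer !big_ord0 fact0 !mul1r.
rewrite hahn_factorsS (IH i.+1); last by rewrite addSnnS.
have := pearson_factor j.+1 f (pearson_rising i pmu).
rewrite !mul_functionalE [rising_poly c i * (_ * _)]mulrA -rising_polyS.
rewrite (_ : c + i%:R + 1 + j.+1%:R = c + k.+1%:R); last first.
  by rewrite -ijk -addnS natrD -!natr1; ring.
move=> <-; rewrite !pochhammerSl factS natrM -!natr1 !addrA; ring.
Qed.

Definition dual_hahn_coef alpha c (k j : nat) : R :=
  pochhammer (- k%:R : R) j
       * pochhammer (1 - alpha - c - k%:R + j%:R) (k - j)
       * pochhammer (1 - c - k%:R + j%:R) (k - j)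
       / j`!%:R * (-1) ^+ j.

Lemma dual_hahn_coefE alpha c (k j : nat) : (j <= k)%N ->
  dual_hahn_coef alpha c k j =
  (k ^_ j)%:R * pochhammer c (k - j) * pochhammer (alpha + c) (k - j) / j`!%:R.
Proof.
move=> jk; rewrite /dual_hahn_coef -(pochhammer_ffact _ jk).
have -> : 1 - alpha - c - k%:R + j%:R = 1 - (alpha + c) - (k - j)%:R.
  by rewrite natrB//; ring.
have -> : 1 - c - k%:R + j%:R = 1 - c - (k - j)%:R by rewrite natrB//; ring.
rewrite !pochhammer_reflect.
set p := pochhammer (- _) j; set q := pochhammer c _.
set r := pochhammer _ (k - j).
rewrite [LHS](_ : _ = (-1) ^+ (k - j) ^+ 2 * (p * (-1) ^+ j * q * r / j`!%:R)).
  by rewrite sqrr_sign mul1r.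
ring.
Qed.

Lemma christoffel_poly_rising c k :
  christoffel_poly c k = rising_poly (c + 1) k.
Proof.
rewrite /christoffel_poly /rising_poly big_add1/= big_mkord.
by apply: eq_bigr => i _; rewrite -natr1 -addrA (addrC 1).
Qed.

(** From the recurrence (x+c+1)_{k+1} = (x+c)_{k+1} + (k+1) (x+c+1)_k of rising
    factorials. *)
Lemma christoffel_polyE c k :
  christoffel_poly c k = \sum_(j < k.+1) (k ^_ j)%:R *: rising_poly c (k - j).
Proof.
rewrite christoffel_poly_rising; elim: k => [|k IH].
  by rewrite big_ord_recl big_ord0 /rising_poly !big_ord0 ffactn0 scale1r addr0.
rewrite big_ord_recl ffactn0 scale1r subn0.
have -> : \sum_(i < k.+1)
    (k.+1 ^_ lift ord0 i)%:R *: rising_poly c (k.+1 - lift ord0 i) =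
    k.+1%:R *: rising_poly (c + 1) k.
  rewrite IH scaler_sumr; apply: eq_bigr => i _.
  by rewrite lift0 subSS ffactSS natrM scalerA.
rewrite [rising_poly c k.+1]rising_polySl rising_polyS -mul_polyC -natr1.
by rewrite !rmorphD/=; ring.
Qed.

(** The key identity: the functional of the statement is, up to a nonzero
    factor, rho_k composed with Y. The dual Hahn coefficients are precisely
    those for which the constants of [pearson_factors] combine to those of
    [christoffel_polyE]. *)
Lemma pearson_krall_sum alpha c N mu k f : pearson alpha c N mu ->
  mu (rising_poly c k
    * krall_sum alpha (c + k.+1%:R) N k (dual_hahn_coef alpha c k) f)
  = pochhammer c k * pochhammer (alpha + c) k * mu (christoffel_poly c k * f).
Proof.
move=> pmu; rewrite /krall_sum christoffel_polyE mulr_sumr mulr_suml.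
rewrite !linear_sum/=.
rewrite mulr_sumr; apply: eq_bigr => j _.
have jk : (j <= k)%N by rewrite -ltnS.
rewrite -scalerAr -scalerAl !linearZ/= (pearson_factors f pmu (subnK jk)).
rewrite -[in pochhammer c k](subnK jk) -[in pochhammer (alpha + c) k](subnK jk).
rewrite !pochhammer_cat dual_hahn_coefE//.
have := pnatr_eq0 R j`!; rewrite gtn_eqF ?fact_gt0// => /negbT nz; field.
exact: nz.
Qed.

Lemma krall_weightE alpha c N k n :
  krall_weight alpha (c + k.+1%:R) N k (dual_hahn_coef alpha c k) n =
  (dual_hahn_poly alpha c N k).[n%:R * (n%:R + alpha + c + k%:R - N - 1)].
Proof.
rewrite /dual_hahn_poly horner_sum; apply: eq_bigr => j _.
rewrite hornerZ horner_prod; congr (_ * _); apply: eq_bigr => i _.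
by rewrite hornerD hornerX hornerC -natr1; ring.
Qed.

(** Divide f by x + c. The remainder contributes mu (q) = 0 by the key identity
    and [krall_sum_poly]; the quotient g contributes rho_{k+1} (g q), which
    vanishes since q involves eigenpolynomials of degree at least n. *)
Lemma krall_poly_orthogonal alpha c N mu k n f :
  (forall m, alpha + (c + k.+1%:R) - N + m.+1%:R != 0) ->
  ~ nonpositive_integer c -> ~ nonpositive_integer (alpha + c) ->
  pearson alpha c N mu -> n%:R + (alpha + (c + k.+1%:R) - N) != 0 ->
  (size f <= n.+1)%N ->
  mul_functional (christoffel_poly c k) mu
    (krall_poly alpha (c + k.+1%:R) N k (dual_hahn_coef alpha c k) n * f) = 0.
Proof.
move=> a_neq c_nz ac_nz pmu na sf.
set q := krall_poly _ _ _ _ _ _.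
have q1 : mul_functional (christoffel_poly c k) mu q = 0.
  rewrite mul_functionalE.
  have nz := mulf_neq0 (pochhammer_neq0 k c_nz) (pochhammer_neq0 k ac_nz).
  apply: (mulfI nz); rewrite -(pearson_krall_sum _ _ pmu) mulr0.
  rewrite krall_sum_poly// -scalerAr functionalZ.
  apply/eqP; rewrite mulf_eq0; apply/orP; right; apply/eqP.
  have := pearson_hahn_op (lowered_eigen alpha (c + k.+1%:R) N n)
    (pearson_rising k pmu).
  rewrite (_ : c + k%:R = c + k.+1%:R - 1); last by rewrite -natr1; ring.
  rewrite lowered_eigenP// functionalZ mul_functionalE => /eqP.
  by rewrite mulf_eq0 oppr_eq0 !mulf_eq0 pnatr_eq0 (negbTE na)/= => /eqP.
pose g := f %/ ('X + c%:P).
have Xc : 'X + c%:P = 'X - (- c)%:P by rewrite polyCN opprK.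
have -> : f = f.[- c]%:P + ('X + c%:P) * g.
  rewrite [LHS](divp_eq f ('X + c%:P)) addrC [_ * ('X + _)]mulrC.
  by rewrite [in _ %% _]Xc modp_XsubC.
have sg : (size g <= n)%N.
  rewrite /g size_divp ?Xc ?polyXsubC_eq0// size_XsubC subn1.
  by case: (size f) sf.
rewrite mulrDr linearD/= mulrC mul_polyC functionalZ q1 mulr0 add0r.
rewrite mul_functionalE.
rewrite (_ : _ * _ = rising_poly c k.+1 * (q * g)); last first.
  by rewrite christoffel_poly_rising rising_polySl; ring.
rewrite -mul_functionalE /q /krall_poly mulrBl linearB/= -!scalerAl !functionalZ.
have ps := pearson_rising k.+1 pmu.
by rewrite !(hahn_eigen_orthogonal a_neq ps) ?mulr0 ?subrr// (leq_trans sg).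
Qed.

(** The difference between q n and the multiple of p with the same leading
    coefficient has degree below n and is orthogonal to all polynomials of
    degree below n, so nondegeneracy in its own degree forces it to vanish. *)
Lemma orthogonal_unique mu (I : pred nat) (q : nat -> {poly R}) n
    (p : {poly R}) :
  orthogonal_family mu I q -> initial_segment I -> I n ->
  size p = n.+1 -> (forall f, (size f <= n)%N -> mu (p * f) = 0) ->
  exists x : R, q n = x *: p.
Proof.
move=> oq iI In sp op.
have qf m f : I m -> (size f <= m)%N -> mu (q m * f) = 0.
  move=> Im; rewrite -mul_functionalE.
  apply: (scalar_eq0_span (b := fun j => 'X^j)) => [|j jm|j jm].
  - by move=> x f1 f2; rewrite linearP.
  - by rewrite size_polyXn.
  - by have [_ h _] := oq m Im; exact: h.
have [sq _ _] := oq n In.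
have lp : lead_coef p != 0 by rewrite lead_coef_eq0 -size_poly_gt0 sp.
exists (lead_coef (q n) / lead_coef p); apply/eqP; rewrite -subr_eq0; apply/eqP.
set x := _ / _; set t := _ - _; apply/eqP; apply: contraT => t0.
have st : (size t <= n)%N.
  apply/leq_sizeP => i; rewrite leq_eqVlt => /predU1P[<-|ni].
    rewrite coefB coefZ.
    have -> : (q n)`_n = lead_coef (q n) by rewrite lead_coefE sq.
    have -> : p`_n = lead_coef p by rewrite lead_coefE sp.
    by rewrite /x divfK ?subrr.
  by rewrite coefB coefZ !nth_default ?sq ?sp// mulr0 subr0.
(* d is the degree of the difference; q_d detects its leading coefficient. *)
have [d sd] : exists d, size t = d.+1.
  by exists (size t).-1; rewrite prednK// size_poly_gt0.
have dn : (d < n)%N by rewrite -sd.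
have Id : I d by apply: iI In; exact: ltnW.
have [sqd _ nzd] := oq d Id.
have e1 : mu (q d * t) = 0.
  rewrite mulrC /t mulrBl linearB/= qf ?sqd// -scalerAl functionalZ.
  by rewrite op ?sqd// mulr0 subrr.
have e2 : mu (q d * (t - lead_coef t *: 'X^d)) = 0.
  apply: qf => //; apply/leq_sizeP => i; rewrite leq_eqVlt => /predU1P[<-|di].
    by rewrite coefB coefZ coefXn eqxx mulr1 lead_coefE sd subrr.
  rewrite coefB coefZ coefXn gtn_eqF// mulr0 subr0 nth_default// sd//.
move: e2; rewrite mulrBr linearB/= e1 sub0r -scalerAr functionalZ => /eqP.
by rewrite oppr_eq0 mulf_eq0 lead_coef_eq0 (negbTE t0) (negbTE nzd).
Qed.

(** For a = 0 the Pearson equation of rho_k with g = 1 reads (c+k) (N-1) rho_k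
    (1) = 0; then apply the key identity to 1. *)
Lemma pearson_degenerate alpha c N mu k : pearson alpha c N mu ->
  alpha + (c + k.+1%:R) - N = 0 -> ~ nonpositive_integer c ->
  ~ nonpositive_integer (alpha + c) -> N != 1 ->
  mul_functional (christoffel_poly c k) mu 1 = 0.
Proof.
move=> pmu a0 c_np ac_np N1.
have pmuk := pearson_rising k pmu.
have ck : c + k%:R != 0.
  by apply/eqP => h; apply: c_np; exists k; apply/eqP; rewrite -addr_eq0 h.
have m1 : mul_functional (rising_poly c k) mu 1 = 0.
  have := pmuk 1; rewrite rmorph1 !mulr1 => /eqP; rewrite -subr_eq0 -linearB/=.
  have -> : hahn_up (c + k%:R) N - hahn_down alpha = (c + k%:R) * (N - 1) *: 1.
    have -> : alpha = N - (c + k%:R + 1) by rewrite -natr1 in a0; lra.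
    rewrite /hahn_up /hahn_down -mul_polyC.
    rewrite !(rmorphB, rmorphD, rmorphM, rmorph1)/=; ring.
  by rewrite functionalZ !mulf_eq0 (negbTE ck) subr_eq0 (negbTE N1)/= => /eqP.
have nz := mulf_neq0 (pochhammer_neq0 k c_np) (pochhammer_neq0 k ac_np).
apply: (mulfI nz); rewrite mul_functionalE -(pearson_krall_sum _ _ pmu) mulr0.
rewrite (@krall_sum_eigen _ _ _ _ _ _ 0%N).
  by rewrite -scalerAr functionalZ -mul_functionalE m1 mulr0.
by rewrite mul0r oppr0 scale0r /hahn_op !rmorph1 !subrr !mulr0 subrr.
Qed.

Lemma krall_op1 alpha c N k (d : nat -> R) : krall_op alpha c N k d 1 = 0.
Proof.
rewrite (@krall_op_eigen _ _ _ _ _ _ 0%N).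
  rewrite /euler_op rmorph1 subrr mulr0 scaler0 add0r /krall_tail.
  rewrite big1 ?scale0r// => j _.
  by rewrite !mul0r mulr0.
by rewrite mul0r oppr0 scale0r /hahn_op !rmorph1 !subrr !mulr0 subrr.
Qed.

Lemma krall_degenerate alpha c N mu k (I : pred nat) (q : nat -> {poly R}) :
  pearson alpha c N mu -> hahn_functional alpha c N mu ->
  alpha + (c + k.+1%:R) - N = 0 -> ~ nonpositive_integer c ->
  ~ nonpositive_integer (alpha + c) -> initial_segment I ->
  orthogonal_family (mul_functional (christoffel_poly c k) mu) I q -> ~ I 1%N.
Proof.
move=> pmu hmu a0 c_np ac_np iI oq I1.
have [N1|N1] := eqVneq N 1; last first.
  have [s0 _] := oq 0%N (iI 0%N 1%N isT I1).
  rewrite expr0 mulr1 (size1_polyC (_ : size (q 0%N) <= 1)%N) ?s0//.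
  rewrite -[_%:P]mulr1 mul_polyC functionalZ.
  by rewrite (pearson_degenerate pmu) ?mulr0 ?eqxx.
case: hmu => [[]|[M [_ NM mE]]]; first by case; exists 1%N.
have M1 : M = 1%N by apply/eqP; rewrite -(eqr_nat R) -NM N1.
have [_ _] := oq 1%N I1; rewrite mul_functionalE mE M1 big_ord_recl big_ord0.
by rewrite !hornerM hornerXn expr1 !mulr0 addr0 mulr0 eqxx.
Qed.

End Christoffel.

(** * Genre of the difference operator *)

Section Bands.
Variable R : realType.
Implicit Types (D : {poly R} -> {poly R}) (t b p u v w : {poly R}).

(** D is a combination of the shifts by -n, ..., n, with top coefficient t and
    bottom coefficient b. The coefficients are indexed from 0 and extended by
    0, so that sequences moved by different amounts can be added. *)
Definition banded (n : nat) D t b : Prop :=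
  exists g : nat -> {poly R},
    [/\ forall i, (n.*2 < i)%N -> g i = 0, g n.*2 = t, g 0%N = b &
        forall p, D p = \sum_(i < n.*2.+1) g i * shift_op (i%:Z - n%:Z) p].

Definition delay (g : nat -> {poly R}) (i : nat) : {poly R} :=
  if i is j.+1 then g j else 0.

Lemma banded_ext n D D' t b : D =1 D' -> banded n D t b -> banded n D' t b.
Proof.
by move=> DD' [g [g0 gt gb gE]]; exists g; split=> // p; rewrite -DD'.
Qed.

Lemma banded_id : banded 0 id 1 1.
Proof.
exists (fun i => if i is 0%N then 1 else 0); split=> // [[]//|p].
by rewrite big_ord_recl big_ord0 addr0 mul1r shift_op0.
Qed.

Lemma banded_succ n D t b : banded n D t b -> banded n.+1 D 0 0.
Proof.
move=> [g [g0 gt gb gE]]; exists (delay g); split=> //.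
- by case=> // i; rewrite doubleS => ni; apply: g0; rewrite -ltnS ltnW.
- by rewrite doubleS /= g0.
move=> p; rewrite gE doubleS [RHS]big_ord_recl/= mul0r add0r.
rewrite [RHS]big_ord_recr/= g0// mul0r addr0; apply: eq_bigr => i _.
by rewrite /bump /= add1n; congr (_ * shift_op _ _); rewrite -!natz -!natr1; ring.
Qed.

Lemma banded_widen m n D t b : (m < n)%N -> banded m D t b -> banded n D 0 0.
Proof.
move=> mn bD; elim: n mn => // n IH; rewrite ltnS leq_eqVlt => /predU1P[<-|/IH].
  exact: banded_succ bD.
exact: banded_succ.
Qed.

Lemma banded_comb n D D' t b t' b' (x y : R) :
  banded n D t b -> banded n D' t' b' ->
  banded n (fun p => x *: D p + y *: D' p)
    (x *: t + y *: t') (x *: b + y *: b').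
Proof.
move=> [g [g0 <- <- gE]] [g' [g'0 <- <- g'E]].
exists (fun i => x *: g i + y *: g' i); split=> // [i ni|p].
  by rewrite g0// g'0// !scaler0 addr0.
rewrite gE g'E !scaler_sumr -big_split/=; apply: eq_bigr => i _.
by rewrite mulrDl !scalerAl.
Qed.

Lemma banded_sum n m (d : nat -> R) (D : nat -> {poly R} -> {poly R}) :
  (forall j, (j < m)%N -> banded n (D j) 0 0) ->
  banded n (fun p => \sum_(j < m) d j *: D j p) 0 0.
Proof.
elim: m => [|m IH] bD.
  exists (fun=> 0); split=> // p; rewrite big_ord0 big1// => i _.
  by rewrite mul0r.
have b1 := IH (fun j jm => bD j (ltnW jm)).
have := banded_comb 1 (d m) b1 (bD m (ltnSn m)); rewrite !scaler0 addr0.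
by apply: banded_ext => p; rewrite big_ord_recr/= scale1r.
Qed.

(** Composition with a first-order operator u s_1 + v + w s_{-1}: each of the
    three terms moves the coefficient sequence by two, one or zero places. *)
Lemma banded_comp n D t b u v w : banded n D t b ->
  banded n.+1
    (fun p => u * shift_op 1 (D p) + v * D p + w * shift_op (-1) (D p))
    (u * shift_op 1 t) (w * shift_op (-1) b).
Proof.
move=> [g [g0 <- <- gE]].
exists (fun i => delay (delay (fun j => u * shift_op 1 (g j))) i
  + delay (fun j => v * g j) i + w * shift_op (-1) (g i)); split.
- move=> [|[|i]]; rewrite doubleS // !ltnS => ni /=.
  rewrite (g0 _ ni) (g0 _ (leqW ni)) (g0 _ (leqW (leqW ni))).
  by rewrite !rmorph0 !mulr0 !addr0.
- by rewrite doubleS/= (g0 n.*2.+1)// (g0 n.*2.+2) ?rmorph0 ?mulr0 ?addr0// ltnW.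
- by rewrite /= !add0r.
move=> p; under [RHS]eq_bigr do rewrite !mulrDl.
rewrite !big_split/= doubleS; congr (_ + _ + _).
- rewrite 2!big_ord_recl/= !mul0r !add0r gE rmorph_sum mulr_sumr.
  apply: eq_bigr => i _; rewrite /bump/= !add1n rmorphM/= shift_opD mulrA.
  by congr (_ * shift_op _ _); rewrite -!natz -!natr1; ring.
- rewrite big_ord_recl/= mul0r add0r big_ord_recr/= g0// mulr0 mul0r addr0.
  rewrite gE mulr_sumr; apply: eq_bigr => i _; rewrite /bump/= !add1n mulrA.
  by congr (_ * shift_op _ _); rewrite -!natz -!natr1; ring.
- rewrite 2!big_ord_recr/= !g0// rmorph0 mulr0 !mul0r !addr0 gE rmorph_sum.
  rewrite mulr_sumr.
  apply: eq_bigr => i _; rewrite rmorphM/= shift_opD mulrA.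
  by congr (_ * shift_op _ _); rewrite -!natz -!natr1; ring.
Qed.

Lemma shift_op_eq0 (l : int) p : (shift_op l p == 0) = (p == 0).
Proof.
apply/eqP/eqP => [h|->]; last by rewrite rmorph0.
by rewrite -[p]shift_op0 -(addNr l) -shift_opD h rmorph0.
Qed.

Lemma hahn_up_neq0 (c N : R) : hahn_up c N != 0.
Proof.
rewrite /hahn_up -[c]opprK polyCN mulf_neq0// ?polyXsubC_eq0//.
by rewrite -opprB oppr_eq0 polyXsubC_eq0.
Qed.

Lemma hahn_down_neq0 (alpha : R) : hahn_down alpha != 0.
Proof.
by rewrite /hahn_down mulf_neq0 ?polyX_eq0// -opprB oppr_eq0 polyXsubC_eq0.
Qed.

Lemma banded_hahn_factors alpha c N j : exists t b,
  [/\ t != 0, b != 0 & banded j (hahn_factors alpha c N j) t b].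
Proof.
elim: j => [|j [t [b [t0 b0 IH]]]].
  by exists 1, 1; rewrite oner_neq0; split=> //; exact: banded_id.
exists (- hahn_up c N * shift_op 1 t), (- hahn_down alpha * shift_op (-1) b).
rewrite !mulf_neq0 ?oppr_eq0 ?shift_op_eq0 ?hahn_up_neq0 ?hahn_down_neq0//.
split=> //; apply: banded_ext (banded_comp _
  (hahn_up c N + hahn_down alpha
    + (j.+1%:R * (alpha + c - N - j.+1%:R))%:P) _ IH).
move=> p; rewrite /= /hahn_factor /hahn_op -mul_polyC; ring.
Qed.

(** Only j = k contributes to the extreme shifts. The leading coefficient of E
    - L / (k+1) is (N-1-x) (1 - (x+c) / (k+1)), which does not vanish
    identically. *)
Lemma banded_krall_op alpha c N k (d : nat -> R) : d k != 0 -> exists t b,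
  [/\ t != 0, b != 0 & banded k.+1 (krall_op alpha c N k d) t b].
Proof.
move=> dk.
pose U j (p : {poly R}) := euler_op N (hahn_factors alpha c N j p)
  - j.+1%:R^-1 *: hahn_op alpha c N (hahn_factors alpha c N j p).
have bU j : exists t b, [/\ t != 0, b != 0 & banded j.+1 (U j) t b].
  have [t [b [t0 b0 bK]]] := banded_hahn_factors alpha c N j.
  have jz : j.+1%:R^-1 != 0 :> R by rewrite invr_eq0 pnatr_eq0.
  pose x := (j.+1%:R^-1 : R)%:P.
  have nz1 : (N - 1)%:P - 'X != 0 :> {poly R}.
    by rewrite -opprB oppr_eq0 polyXsubC_eq0.
  have nz2 : 1 - x * ('X + c%:P) != 0.
    apply/eqP => /(congr1 (fun q : {poly R} => q`_1)).
    rewrite !coefE/= addr0 mulr1 sub0r => /eqP.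
    by rewrite oppr_eq0 (negbTE jz).
  exists (((N - 1)%:P - 'X) * (1 - x * ('X + c%:P)) * shift_op 1 t),
    (- (x * hahn_down alpha) * shift_op (-1) b); split.
  - by rewrite !mulf_neq0 ?shift_op_eq0.
  - rewrite mulf_neq0 ?shift_op_eq0// oppr_eq0.
    by rewrite mulf_neq0 ?hahn_down_neq0// polyC_eq0.
  apply: banded_ext (banded_comp _ (x * (hahn_up c N + hahn_down alpha)
    - ((N - 1)%:P - 'X)) _ bK) => p.
  by rewrite /U /hahn_op /euler_op -mul_polyC -/x /hahn_up; ring.
have [t [b [t0 b0 bUk]]] := bU k.
exists (d k *: t), (d k *: b); rewrite !scaler_eq0 !negb_or dk; split=> //.
have low : banded k.+1 (fun p => \sum_(j < k) d j *: U j p) 0 0.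
  by apply: banded_sum => j jk; have [t' [b' [_ _]]] := bU j; apply: banded_widen.
have := banded_comb 1 (d k) low bUk; rewrite !scaler0 !add0r.
by apply: banded_ext => p; rewrite scale1r /krall_op big_ord_recr.
Qed.

Lemma banded_has_genre n D t b : t != 0 -> b != 0 -> banded n D t b ->
  has_genre D (- n%:Z) n%:Z.
Proof.
move=> t0 b0 [g [_ gt gb gE]].
pose s := - n%:Z.
have e (i : nat) : absz (s + i%:Z - s)%R = i by rewrite addrC addKr absz_nat.
exists (fun z => g (absz (z - s)%R)); split.
- by rewrite -/s /s; lia.
- by rewrite subrr gb.
- by rewrite (_ : absz _ = n.*2) ?gt// /s; lia.
move=> p; rewrite gE (_ : absz _ = n.*2); last by rewrite /s; lia.
by apply: eq_bigr => i _; rewrite e addrC.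
Qed.

End Bands.

Theorem corollary7p6 (R : realType) (k : nat) (alpha c N : R)
    (rho : {scalar {poly R}}) :
  (0 < k)%N ->
  ~ nonpositive_integer (alpha + c - N + k%:R + 2) ->
  ~ nonpositive_integer (alpha - N + 1) ->
  ~ nonpositive_integer (alpha + c) ->
  ~ nonpositive_integer c ->
  hahn_functional alpha c N rho ->
  (forall n : nat,
     (dual_hahn_poly alpha c N k).[n%:R * (n%:R + alpha + c + k%:R - N - 1)]
       != 0) ->
  exists D : {poly R} -> {poly R},
    [/\ has_order D (2 * k + 2),
        has_genre D (- (k%:Z) - 1) (k%:Z + 1) &
        forall (I : pred nat) (q : nat -> {poly R}),
          initial_segment I ->
          orthogonal_family (mul_functional (christoffel_poly c k) rho) I q ->
          common_eigenfunctions D I q].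
Proof.
move=> k0 a_np al_np ac_np c_np hrho h_nz.
have pmu := pearson_hahn al_np c_np hrho.
pose d := dual_hahn_coef alpha c k.
have a_neq m : alpha + (c + k.+1%:R) - N + m.+1%:R != 0.
  apply/eqP => h; apply: a_np; exists m; apply/eqP; rewrite -addr_eq0 -h.
  by rewrite -!natr1; apply/eqP; ring.
have dk : d k != 0.
  rewrite /d dual_hahn_coefE// subnn /pochhammer !big_ord0 !mulr1 ffactnn.
  by rewrite divff ?oner_neq0.
have genre : has_genre (krall_op alpha (c + k.+1%:R) N k d)
    (- k%:Z - 1) (k%:Z + 1).
  have [t [b [t0 b0]]] := banded_krall_op alpha (c + k.+1%:R) N dk.
  move=> /(banded_has_genre t0 b0).
  by rewrite -addn1 PoszD opprD.
exists (krall_op alpha (c + k.+1%:R) N k d); split=> //.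
  by exists (- k%:Z - 1), (k%:Z + 1); split=> //; lia.
move=> I q iI oq; exists (krall_eigenvalue alpha (c + k.+1%:R) N k d) => n In.
case: n In => [|n] In.
  have [s0 _ _] := oq 0%N In.
  rewrite (size1_polyC (_ : size (q 0%N) <= 1)%N) ?s0//.
  rewrite -[_%:P]mulr1 mul_polyC (linearZ_LR (krall_op _ _ _ _ _))/=.
  rewrite krall_op1 scaler0.
  rewrite /krall_eigenvalue big1 ?scale0r// => j _.
  by rewrite big_ord_recl addr0 !mul0r mulr0.
(* n + a and 2n + a can vanish only for a = n = 0, the degenerate case. *)
have a_nz m : (0 < m)%N || (alpha + (c + k.+1%:R) - N != 0) ->
    m%:R + (alpha + (c + k.+1%:R) - N) != 0.
  by case: m => [|m] h; [rewrite add0r | rewrite [_ + (_ - N)]addrC a_neq].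
have n_nz : (0 < n)%N || (alpha + (c + k.+1%:R) - N != 0).
  case: n In => //= I1; apply/eqP => a0.
  exact: (krall_degenerate pmu hrho a0 c_np ac_np iI oq I1).
have weight_nz m : krall_weight alpha (c + k.+1%:R) N k d m != 0.
  by rewrite krall_weightE h_nz.
have [x ->] : exists x : R,
    q n.+1 = x *: krall_poly alpha (c + k.+1%:R) N k d n.
  apply: (orthogonal_unique oq iI In).
  - by apply: size_krall_poly => //; rewrite a_nz// double_gt0.
  - by move=> f sf; apply: krall_poly_orthogonal => //; exact: a_nz.
rewrite (linearZ_LR (krall_op _ _ _ _ _))/= krall_op_poly//.
by rewrite !scalerA mulrC.
Qed.
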